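(* Let $n\ge 6$ be an integer and let $p,q\ge 3$ be two integers satisfying $n=p+q$. Let $f$ be a spatial embedding of the complete graph $K_n$. (1) If $p=q$, then modulo $2\cdot (n-6)!$, $$\sum_{\lambda\in\Gamma_{p,q}(K_n)}\mathrm{lk}(f(\lambda))^2\equiv\begin{cases}(n-6)! & (n\equiv 6,7\pmod 8),\\ 0 & (n\not\equiv 6,7\pmod 8).\end{cases}$$ (2) If $p\neq q$, then modulo $4\cdot (n-6)!$, $$\sum_{\lambda\in\Gamma_{p,q}(K_n)}\mathrm{lk}(f(\lambda))^2\equiv\begin{cases}2\cdot(n-6)! & (n\equiv 6,7\pmod 8),\\ 0 & (n\not\equiv 6,7\pmod 8).\end{cases}$$ (3) Modulo $2\cdot (n-5)!$, $$\sum_{p+q=n}\ \sum_{\lambda\in\Gamma_{p,q}(K_n)}\mathrm{lk}(f(\lambda))^2\equiv\begin{cases}(n-5)! & (n\equiv 6,7\pmod 8),\\ 0 & (n\not\equiv 6,7\pmod 8),\end{cases}$$ where the outer sum runs over all unordered pairs $\{p,q\}$ of integers $p,q\ge 3$ with $p+q=n$.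
   Context: We work in the piecewise linear category. $K_n$ is the complete graph on the $n$ vertices $1,\dots,n$. A spatial embedding of a finite graph $G$ is a (piecewise linear) embedding $f$ of $G$ into $\mathbb{R}^3$. A cycle of $G$ is a subgraph homeomorphic to a circle; a $p$-cycle is a cycle with exactly $p$ edges. $\Gamma_{p,q}(G)$ denotes the set of all unordered pairs $\lambda=\gamma\cup\gamma'$ of two (vertex-)disjoint cycles of $G$ consisting of a $p$-cycle and a $q$-cycle. For such $\lambda$, $f(\lambda)$ is a 2-component link and $\mathrm{lk}(f(\lambda))$ is its linking number; it is defined up to sign unless the components are oriented, so $\mathrm{lk}(f(\lambda))^2$ is well defined. *)

(* Defs.v *)
From HB Require Import structures.
From mathcomp Require Import all_boot all_order all_algebra.
From mathcomp Require Import boolp reals.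
From mathcomp Require classical_sets.
Set Implicit Arguments.
Unset Strict Implicit.
Unset Printing Implicit Defensive.
Import Order.TTheory GRing.Theory Num.Theory.
Local Open Scope ring_scope.

Section Polygons.
Variable R : realType.
Notation point := 'rV[R]_3.

Definition on_segment (a b : point) (t : R) : point := (1 - t) *: a + t *: b.

Definition segment (a b x : point) : Prop :=
  exists2 t : R, 0 <= t <= 1 & x = on_segment a b t.

Definition path_sides (P : seq point) : seq (point * point) :=
  zip P (behead P).

(* The sides of the closed polygon with cyclic vertex sequence K, oriented by
   the order of the sequence. *)
Definition sides (K : seq point) : seq (point * point) := zip K (rot 1 K).

Definition path_support (P : seq point) (x : point) : Prop :=
  exists2 s, s \in path_sides P & segment s.1 s.2 x.

(* The path with vertices P is an embedded arc: no side is degenerate, and two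
   sides meet only if they are consecutive, and then only in the vertex they
   share. *)
Definition simple_path (P : seq point) : Prop :=
  (forall i, (i.+1 < size P)%N -> P`_i <> P`_i.+1) /\
  (forall i j x, (i < j)%N -> (j.+1 < size P)%N ->
     segment P`_i P`_i.+1 x -> segment P`_j P`_j.+1 x ->
     j = i.+1 /\ x = P`_j).

Definition det3 (u v w : point) : R :=
  \det (\matrix_(i < 3) nth 0 [:: u; v; w] i).

(* Seen from the direction v (v points towards the observer), the interior of
   the side s passes over the interior of the side s'. *)
Definition over (v : point) (s s' : point * point) : Prop :=
  exists t t' h : R, [/\ 0 < t < 1, 0 < t' < 1, 0 < h &
    on_segment s.1 s.2 t = on_segment s'.1 s'.2 t' + h *: v].

(* The right-handed sign of a crossing of two oriented sides in the projection
   along v (0 if there is no crossing): the over-strand comes first in the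
   determinant. *)
Definition crossing_sign (v : point) (s s' : point * point) : int :=
  if `[< over v s s' >] then sgz (det3 (s.2 - s.1) (s'.2 - s'.1) v)
  else if `[< over v s' s >] then sgz (det3 (s'.2 - s'.1) (s.2 - s.1) v)
  else 0.

(* Projecting along v, no vertex of one polygon falls on the image of the
   other. The images of the two polygons then meet only in transverse crossings
   of sides; crossings of a component with itself do not matter for lk. *)
Definition regular_direction (K L : seq point) (v : point) : Prop :=
  [/\ v <> 0,
    forall a s t h, a \in K -> s \in sides L -> 0 <= t <= 1 ->
      a <> on_segment s.1 s.2 t + h *: v
  & forall a s t h, a \in L -> s \in sides K -> 0 <= t <= 1 ->
      a <> on_segment s.1 s.2 t + h *: v].

(* The linking number of two disjoint oriented closed polygons: half the sum of
   the signs of the crossings between the two components in some regular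
   projection. That sum is even, so the division is exact. *)
Definition linking_number (K L : seq point) : int :=
  let v := classical_sets.xget 0 (regular_direction K L) in
  ((\sum_(s <- sides K) \sum_(s' <- sides L) crossing_sign v s s') %/ 2)%Z.

End Polygons.

(* A finite simple graph is a symmetric irreflexive relation e on a finType. *)
Definition complete (n : nat) : rel 'I_n := [rel i j | i != j].

(* A subgraph without isolated vertices is given by its set of edges, an edge
   being the set of its two ends; its vertex set is then cover C. *)
Section Cycles.
Variables (T : finType) (e : rel T).

Definition cycle_edges (s : seq T) : {set {set T}} :=
  [set [set x; next s x] | x in s].

(* s lists, in cyclic order, the vertices of the p-cycle C of the graph. *)
Definition traverses (p : nat) (s : p.-tuple T) (C : {set {set T}}) : bool :=
  ucycleb e s && (C == cycle_edges s).

Definition is_cycle (p : nat) (C : {set {set T}}) : bool :=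
  (3 <= p)%N && [exists s : p.-tuple T, traverses s C].

(* Unordered pairs of disjoint cycles, hence sets of two cycles. *)
Definition Gamma (p q : nat) : {set {set {set {set T}}}} :=
  [set [set C; D] | C in is_cycle p, D in is_cycle q
                  & [disjoint cover C & cover D]].

(* An arbitrary orientation (and base point) of the cycle C. *)
Definition orientation (C : {set {set T}}) : seq T :=
  if [pick s : #|C|.-tuple T | traverses s C] is Some s then s else [::].

End Cycles.

Section SpatialEmbeddings.
Variables (R : realType) (T : finType) (e : rel T).
Notation point := 'rV[R]_3.

Definition edge_path (pos : T -> point) (brk : T -> T -> seq point) (x y : T) :
  seq point := pos x :: rcons (brk x y) (pos y).

(* A piecewise linear embedding of the graph is a map that is affine on the
   edges of a subdivision, and injective. It is given by the images pos of the
   vertices and, for each edge xy, by the images brk x y, listed from x to y, of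
   the interior vertices of the subdivision. *)
Record spatial_embedding := SpatialEmbedding {
  pos : T -> point;
  brk : T -> T -> seq point;
  brk_sym : forall x y, e x y -> brk y x = rev (brk x y);
  pos_inj : injective pos;
  edge_simple : forall x y, e x y -> simple_path (edge_path pos brk x y);
  vertex_edge : forall z x y, e x y ->
    path_support (edge_path pos brk x y) (pos z) -> z \in [set x; y];
  edge_edge : forall x y z w a, e x y -> e z w -> [set x; y] != [set z; w] ->
    path_support (edge_path pos brk x y) a ->
    path_support (edge_path pos brk z w) a ->
    exists2 u, u \in [set x; y] :&: [set z; w] & a = pos u
}.

(* The closed polygon onto which f maps the cycle with cyclic vertex sequence
   s. *)
Definition cycle_image (f : spatial_embedding) (s : seq T) : seq point :=
  flatten [seq pos f x :: brk f x (next s x) | x <- s].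

(* lk (f lambda) for a pair lambda of disjoint cycles, with respect to arbitrary
   orientations of the two cycles; only its square is meaningful. *)
Definition lk (f : spatial_embedding) (lambda : {set {set {set T}}}) : int :=
  if enum lambda is [:: C; D] then
    linking_number (cycle_image f (orientation e C))
                   (cycle_image f (orientation e D))
  else 0.

End SpatialEmbeddings.

(* Main.v *)
Require Import Defs.
From HB Require Import structures.
From mathcomp Require Import all_boot all_order all_algebra.
From mathcomp Require Import boolp reals.
From mathcomp Require Import ring lra zify.
From mathcomp Require classical_sets.
Set Implicit Arguments.
Unset Strict Implicit.
Unset Printing Implicit Defensive.
Import Order.TTheory GRing.Theory Num.Theory.
Local Open Scope ring_scope.

(** Two ideas carry the proof: linking numbers are bilinear in the edges, and
the whole sum is then determined by pairs of triangles.

Bilinearity.  For a direction [v] in general position, let [total_over v K L]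
be the signed number of crossings at which [K] passes over [L] in the
projection along [v].  It is the degree over [v] of the map from the torus to
the sphere of directions given by the differences of a point of [K] and a point
of [L], so it does not depend on [v].  Concretely, if the direction moves from
[v] to [w], the contribution of a pair of sides changes only by terms attached
to the edges of the parallelogram of differences (over_sign_diff), and these
telescope along closed polygons (total_over_indep).  Comparing [v] with [- v]
shows that [K] passes over [L] as often as [L] over [K], whence the halved sum
of crossing signs equals [total_over v K L] for every generic [v]
(linking_numberE).  One direction that is generic for all edges therefore
expresses every linking number as the sum, over the pairs of an edge of the one
cycle and an edge of the other, of a number which is antisymmetric under the
reversal of either edge (linking_number_cycles, cycle_lkE).

Reduction to triangles.  For antisymmetric [phi], sum the square of the total
of [phi] around a closed tuple over all injective [k]-tuples in a set.  The
products of the values of [phi] at two arcs without common vertex cancel, and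
what is left depends on [k] only through a factor (tsum_cyc_triangles).  Used
for one component of the link and then for the other, this gives
[sum_Gamma_lk_sqr]: the sum over Gamma_(p,q), doubled if [p = q], is
[2 * (n - 6)!] times the sum S over pairs of triangles.

Parity of S.  Each set of six vertices contributes an odd number (K6_odd), so
S has the parity of ['C(n, 6)], which is odd exactly if [n] is 6 or 7 modulo 8.
Modulo 2, the ten linking numbers in a K6 count the crossings, in the
projection, of disjoint edges of the K5 that remains when one vertex is taken
away.  Turning the direction from [v] to [- v] through a half-plane expresses
each of these crossing numbers by the ends of one edge lying above the other
edge, and by the order of the four ends from left to right in the projection
(edge_over_cross).  In K5 every pair of a vertex and an edge occurs twice, and
what is left is the number of pairs of disjoint edges whose ends interleave in
this order: one for each of the five sets of four vertices.

The three congruences follow by arithmetic; for the last one, there are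
[n - 5] ordered pairs [(p, q)]. *)

(** * A segment in the plane against two rays *)

Lemma affine_root (R : realFieldType) (b t k : R) :
  0 < k -> b * (b + k * t) < 0 ->
  [/\ t != 0, 0 <= - b / t <= k & b + (- b / t) * t = 0].
Proof.
move=> k0 h; have t0 : t != 0 by apply/eqP=> te; move: h; rewrite te; nra.
split=> //; last by field.
case: (ltrgt0P t) (t0) => // ht _.
  have kt : 0 < k * t by rewrite mulr_gt0.
  have b_lt : b < 0 by rewrite ltNge; apply/negP => b_ge; nra.
  have end_gt : 0 < b + k * t by rewrite ltNge; apply/negP => end_le; nra.
  by rewrite ler_pdivlMr // ler_pdivrMr // mul0r; apply/andP; split; lra.
have kt : k * t < 0 by rewrite pmulr_rlt0.
have b_gt : 0 < b by rewrite ltNge; apply/negP => b_le; nra.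
have end_lt : b + k * t < 0 by rewrite ltNge; apply/negP => end_ge; nra.
by rewrite ler_ndivlMr // ler_ndivrMr // mul0r; apply/andP; split; lra.
Qed.

(** The point where the segment meets the axis of the ray has coordinate
[(a * t - b * s) / t] along that axis, so the sign of [a * t - b * s] and the
direction of the passage decide whether the ray itself is met. *)
Lemma signed_ray_crossing (R : realFieldType) (a b s t k : R) :
  0 < k -> b != 0 -> b + k * t != 0 ->
  sgz t * `[< exists2 l : R, 0 <= l <= k & 0 < a + l * s /\ b + l * t = 0 >]%:Z
  = [&& b < 0, 0 < b + k * t & 0 < a * t - b * s]%:Z
    - [&& b + k * t < 0, 0 < b & a * t - b * s < 0]%:Z.
Proof.
set D := a * t - b * s; move=> k0 b0 b20.
have -> : `[< exists2 l : R, 0 <= l <= k & 0 < a + l * s /\ b + l * t = 0 >]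
    = (b * (b + k * t) < 0) && (0 < D * t).
  apply/asboolP/andP => [[l /andP[l0 lk] [al bl]]|[bb Dt]].
    have e : b = - (l * t) by apply: (addIr (l * t)); rewrite bl addNr.
    have bb : b * (b + k * t) < 0.
      rewrite lt_neqAle mulf_neq0 //= e.
      have -> : - (l * t) * (- (l * t) + k * t) = - (l * (k - l) * t ^+ 2) by ring.
      by rewrite oppr_le0 mulr_ge0 ?sqr_ge0 ?mulr_ge0 ?subr_ge0.
    split=> //; have [t0 _ _] := affine_root k0 bb.
    have -> : D * t = (a + l * s) * t ^+ 2 by rewrite /D e; ring.
    by rewrite mulr_gt0 // exprn_even_gt0.
  have [t0 inl rt] := affine_root k0 bb; exists (- b / t) => //; split=> //.
  have -> : a + - b / t * s = (D * t) / t ^+ 2 by rewrite /D; field.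
  by rewrite divr_gt0 // exprn_even_gt0.
case: (ltrgt0P b) b0 => // h1 _; case: (ltrgt0P (b + k * t)) b20 => // h2 _ /=;
  rewrite ?andbF ?subr0 ?sub0r.
- by rewrite ltNge mulr_ge0 ?ltW //=; exact: mulr0.
- have ht : t < 0 by rewrite -(pmulr_rlt0 _ k0); lra.
  by rewrite (ltr0_sgz ht) pmulr_rlt0 // h2 nmulr_lgt0 //= mulN1r.
- have ht : 0 < t by rewrite -(pmulr_rgt0 _ k0); lra.
  by rewrite (gtr0_sgz ht) nmulr_rlt0 // h2 pmulr_lgt0 //= mul1r.
- by rewrite ltNge mulr_le0 ?ltW //=; exact: mulr0.
Qed.

(** A path in the plane that avoids the origin enters or leaves the open
quadrant only through one of its two bounding rays, so the signed count of
passages is the difference of the indicators at the two ends. *)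
Lemma segment_crosses_rays (R : realFieldType) (x1 y1 tx ty k : R) :
  let x2 := x1 + k * tx in let y2 := y1 + k * ty in
  0 < k -> x1 != 0 -> y1 != 0 -> x2 != 0 -> y2 != 0 ->
  (forall l : R, 0 <= l <= k -> ~ (x1 + l * tx = 0 /\ y1 + l * ty = 0)) ->
  sgz ty * `[< exists2 l : R, 0 <= l <= k & 0 < x1 + l * tx /\ y1 + l * ty = 0 >]%:Z
  + sgz tx * `[< exists2 l : R, 0 <= l <= k & x1 + l * tx = 0 /\ 0 < y1 + l * ty >]%:Z
  = ((0 < x2) && (0 < y2))%:Z - ((0 < x1) && (0 < y1))%:Z.
Proof.
move=> x2 y2 k0 x10 y10 x20 y20 off0; set D := x1 * ty - y1 * tx.
(* up to the factor k, D is the determinant of the two ends *)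
have Dk : D * k = x1 * y2 - y1 * x2 by rewrite /D /x2 /y2; ring.
have D0 : (x1 * x2 < 0) || (y1 * y2 < 0) -> D != 0.
  case/orP=> /(affine_root k0)[t0 inl rt]; apply/eqP=> De;
    apply: (off0 _ inl); split=> //.
    have /eqP : (y1 + - x1 / tx * ty) * tx = 0 by rewrite -[RHS]oppr0 -De /D; field.
    by rewrite mulf_eq0 (negbTE t0) orbF => /eqP.
  have /eqP : (x1 + - y1 / ty * tx) * ty = 0 by rewrite -[RHS]De /D; field.
  by rewrite mulf_eq0 (negbTE t0) orbF => /eqP.
have -> : `[< exists2 l : R, 0 <= l <= k & x1 + l * tx = 0 /\ 0 < y1 + l * ty >]
    = `[< exists2 l : R, 0 <= l <= k & 0 < y1 + l * ty /\ x1 + l * tx = 0 >].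
  by apply/asboolP/asboolP => -[l lk [? ?]]; exists l.
rewrite !signed_ray_crossing // -/x2 -/y2 -/D.
have -> : y1 * tx - x1 * ty = - D by rewrite opprB.
rewrite oppr_gt0 oppr_lt0; clearbody x2 y2 D; clear off0.
case: (ltrgt0P x1) x10 => // hx1 _; case: (ltrgt0P x2) x20 => // hx2 _;
case: (ltrgt0P y1) y10 => // hy1 _; case: (ltrgt0P y2) y20 => // hy2 _;
case: (ltrgt0P D) => // hD; rewrite ?andbF ?andbT //=;
try (by exfalso; have : D != 0 by [apply: D0; apply/orP; (left; nra) || (right; nra)];
     rewrite hD eqxx);
exfalso; nra.
Qed.

(** * The boundary formula for a parallelogram *)

Lemma asbool_eq (P Q : Prop) : (P <-> Q) -> `[< P >] = `[< Q >].
Proof. by move=> PQ; apply/asboolP/asboolP => /PQ. Qed.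

(** In the unit square, the line [z0 + t * z1 - t' * z2 = 0], of nonnegative
slope, is entered from the left edge or from the bottom edge according to the
sign of [z0]; the other of these two edges does not meet it.  [C] is an
arbitrary condition along the line: it will single out an open quadrant. *)
Lemma line_enters_square (R : realFieldType) (z0 z1 z2 : R) (C : R -> R -> Prop) :
  0 <= z1 -> 0 <= z2 -> z0 != 0 -> z0 < z2 -> 0 < z0 + z1 ->
  (forall t t', C t t' -> z0 + t * z1 - t' * z2 = 0) ->
  exists te te' : R,
    [/\ 0 <= te <= 1, 0 <= te' <= 1, (te == 0) || (te' == 0),
        z0 + te * z1 - te' * z2 = 0
      & sgz z1 * `[< exists2 t, 0 <= t <= 1 & C t 0 >]%:Z
        + sgz z2 * `[< exists2 t', 0 <= t' <= 1 & C 0 t' >]%:Z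
        = `[< C te te' >]%:Z] /\
    (forall t t', 0 <= t <= 1 -> 0 <= t' <= 1 -> z0 + t * z1 - t' * z2 = 0 ->
       te <= t /\ te' <= t').
Proof.
move=> z1p z2p z0n zlt zgt CZ; case: (ltrgt0P z0) z0n => // hz _.
  have z2q : 0 < z2 by lra.
  have rt : z0 + 0 * z1 - (z0 / z2) * z2 = 0 by rewrite divfK ?gt_eqF //; ring.
  have inl : 0 <= z0 / z2 <= 1.
    by apply/andP; split; [rewrite divr_ge0 // ltW | rewrite ler_pdivrMr // mul1r ltW].
  exists 0, (z0 / z2); split; first split=> //.
  - by rewrite lexx ler01.
  - by rewrite eqxx.
  - have -> : `[< exists2 t, 0 <= t <= 1 & C t 0 >] = false.
      apply/asboolP => -[t /andP[t0 t1] /CZ e].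
      have tz : 0 <= t * z1 by rewrite mulr_ge0.
      by lra.
    rewrite mulr0 add0r (gtr0_sgz z2q) mul1r; congr (nat_of_bool _)%:Z.
    apply: asbool_eq; split=> [[t' _ c]|c]; last by exists (z0 / z2).
    suff <- : t' = z0 / z2 by [].
    have := CZ _ _ c; rewrite mul0r addr0 => /eqP; rewrite subr_eq0 => /eqP ->.
    by rewrite mulfK // gt_eqF.
  - move=> t t' /andP[t0 _] _ e; split=> //; rewrite ler_pdivrMr //.
    have tz : 0 <= t * z1 by rewrite mulr_ge0.
    by lra.
have z1q : 0 < z1 by lra.
have rt : z0 + (- z0 / z1) * z1 - 0 * z2 = 0 by rewrite divfK ?gt_eqF //; ring.
have inl : 0 <= - z0 / z1 <= 1.
  apply/andP; split; first by rewrite divr_ge0 ?oppr_ge0 // ltW.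
  by rewrite ler_pdivrMr // mul1r; lra.
exists (- z0 / z1), 0; split; first split=> //.
- by rewrite lexx ler01.
- by rewrite eqxx orbT.
- have -> : `[< exists2 t', 0 <= t' <= 1 & C 0 t' >] = false.
    apply/asboolP => -[t /andP[t0 t1] /CZ e].
    have tz : 0 <= t * z2 by rewrite mulr_ge0.
    by lra.
  rewrite mulr0 addr0 (gtr0_sgz z1q) mul1r; congr (nat_of_bool _)%:Z.
  apply: asbool_eq; split=> [[t _ c]|c]; last by exists (- z0 / z1).
  suff <- : t = - z0 / z1 by [].
  have := CZ _ _ c; rewrite mul0r subr0 => /eqP; rewrite addrC addr_eq0 => /eqP <-.
  by rewrite mulfK // gt_eqF.
- move=> t t' _ /andP[t0 _] e; split=> //; rewrite ler_pdivrMr //.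
  have tz : 0 <= t' * z2 by rewrite mulr_ge0.
  by lra.
Qed.

Section Square.
Variable R : realFieldType.
Implicit Types (c t : R).

(** The sign of [c2] suits differences of a point of one segment, with parameter
[t], and a point of another, with parameter [t']. *)
Definition affine2 c0 c1 c2 t t' : R := c0 + t * c1 - t' * c2.

Definition square_boundary t t' : bool :=
  [&& 0 <= t <= 1, 0 <= t' <= 1 & ~~ ((0 < t < 1) && (0 < t' < 1))].

Lemma affine2_rev1 c0 c1 c2 t t' :
  affine2 (c0 + c1) (- c1) c2 t t' = affine2 c0 c1 c2 (1 - t) t'.
Proof. by rewrite /affine2; ring. Qed.

Lemma affine2_rev2 c0 c1 c2 t t' :
  affine2 (c0 - c2) c1 (- c2) t t' = affine2 c0 c1 c2 t (1 - t').
Proof. by rewrite /affine2; ring. Qed.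

Lemma rev01 t : (0 <= 1 - t <= 1) = (0 <= t <= 1).
Proof. by apply/idP/idP => /andP[? ?]; apply/andP; split; lra. Qed.

Lemma rev01_lt t : (0 < 1 - t < 1) = (0 < t < 1).
Proof. by apply/idP/idP => /andP[? ?]; apply/andP; split; lra. Qed.

Lemma exists_rev01 (P : R -> Prop) :
  (exists2 t, 0 <= t <= 1 & P (1 - t)) <-> (exists2 t, 0 <= t <= 1 & P t).
Proof.
split=> -[t t01 Pt]; exists (1 - t); rewrite ?rev01 //.
by rewrite opprB addrC subrK.
Qed.

Variables (x0 x1 x2 y0 y1 y2 z0 z1 z2 : R).
Let X := affine2 x0 x1 x2.
Let Y := affine2 y0 y1 y2.
Let Z := affine2 z0 z1 z2.
Let C t t' : Prop := [/\ 0 < X t t', 0 < Y t t' & Z t t' = 0].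

(** [X], [Y], [Z] are coordinates of a parallelogram in space. It avoids the
origin, its vertices avoid the plane [Z = 0], and its edges avoid the lines
spanned by the first two basis vectors. *)
Definition square_generic : Prop :=
  [/\ [/\ Z 0 0 != 0, Z 1 0 != 0, Z 0 1 != 0 & Z 1 1 != 0],
      forall t t', square_boundary t t' -> ~ (Y t t' = 0 /\ Z t t' = 0),
      forall t t', square_boundary t t' -> ~ (X t t' = 0 /\ Z t t' = 0)
    & forall t t', 0 <= t <= 1 -> 0 <= t' <= 1 ->
        ~ [/\ X t t' = 0, Y t t' = 0 & Z t t' = 0]].

(** The left side counts, with signs, the passages of the parallelogram through
the positive [X]-axis and through the positive [Y]-axis. On the right, [C] is
the open quadrant between these half-axes, and its crossings with the four
edges are counted. *)
Definition square_degree : Prop :=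
  sgz (z2 * y1 - z1 * y2) *
    `[< exists t t', [/\ 0 < t < 1, 0 < t' < 1
                       & [/\ 0 < X t t', Y t t' = 0 & Z t t' = 0]] >]%:Z
  + sgz (z2 * x1 - z1 * x2) *
    `[< exists t t', [/\ 0 < t < 1, 0 < t' < 1
                       & [/\ X t t' = 0, 0 < Y t t' & Z t t' = 0]] >]%:Z
  = sgz z1 * (`[< exists2 t, 0 <= t <= 1 & C t 1 >]%:Z
              - `[< exists2 t, 0 <= t <= 1 & C t 0 >]%:Z)
    + sgz z2 * (`[< exists2 t', 0 <= t' <= 1 & C 1 t' >]%:Z
              - `[< exists2 t', 0 <= t' <= 1 & C 0 t' >]%:Z).

(** The parallelogram meets the plane [Z = 0] in a segment whose ends lie on two
of its edges; apply [segment_crosses_rays] to that segment. *)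
Lemma square_degree_pos : 0 <= z1 -> 0 <= z2 -> square_generic -> square_degree.
Proof.
move=> z1p z2p [[c00 c10 c01 c11] by_ bx_ off0].
rewrite /Z /affine2 !mul0r !mul1r ?addr0 ?subr0 in c00 c10 c01 c11.
have ZC t t' : C t t' -> z0 + t * z1 - t' * z2 = 0 by case.
have in0 : 0 <= (0 : R) <= 1 by rewrite ler01 lexx.
have in1 : 0 <= (1 : R) <= 1 by rewrite ler01 lexx.
have inS t : 0 < t < 1 -> 0 <= t <= 1 by case/andP=> ? ?; rewrite !ltW.
have empty : (forall t t', 0 <= t <= 1 -> 0 <= t' <= 1 -> Z t t' <> 0) -> square_degree.
  move=> Zn; rewrite /square_degree !asboolF ?subr0 ?mulr0 //.
  - by case=> t' t'01 [_ _ /Zn]; apply.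
  - by case=> t' t'01 [_ _ /Zn]; apply.
  - by case=> t' t'01 [_ _ /Zn]; apply.
  - by case=> t' t'01 [_ _ /Zn]; apply.
  - by case=> t [t' [/inS t01 /inS t'01 [_ _ /Zn]]]; apply.
  - by case=> t [t' [/inS t01 /inS t'01 [_ _ /Zn]]]; apply.
case: (ltP 0 (z0 + z1)) => [hz1|hz1]; last first.
  apply: empty => t t' /andP[t0 t1] /andP[t0' t1'] e.
  have h1 : 0 <= (1 - t) * z1 by rewrite mulr_ge0 // subr_ge0.
  have h2 : 0 <= t' * z2 by rewrite mulr_ge0.
  by move: e c10; rewrite /Z /affine2 => e /eqP[]; lra.
case: (ltP z0 z2) => [hz2|hz2]; last first.
  apply: empty => t t' /andP[t0 t1] /andP[t0' t1'] e.
  have h1 : 0 <= t * z1 by rewrite mulr_ge0 // subr_ge0.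
  have h2 : 0 <= (1 - t') * z2 by rewrite mulr_ge0 // subr_ge0.
  by move: e c01; rewrite /Z /affine2 => e /eqP[]; lra.
(* entry point of the line Z = 0 into the square *)
have [te [te' [[te01 te'01 teb Ze Ce] emin]]] :=
  line_enters_square z1p z2p c00 hz2 hz1 ZC.
(* the exit point is the entry point after the half-turn of the square *)
pose D t t' := C (1 - t) (1 - t').
have ZD t t' : D t t' -> - (z0 + z1 - z2) + t * z1 - t' * z2 = 0.
  by case=> _ _; rewrite /Z /affine2; lra.
have [] := @line_enters_square _ _ z1 z2 D z1p z2p _ _ _ ZD.
- by rewrite oppr_eq0.
- by lra.
- by lra.
move=> sx [sx' [[sx01 sx'01 sxb Zx Cx] xmin]].
pose tx := 1 - sx; pose tx' := 1 - sx'.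
have exitC : sgz z1 * `[< exists2 t, 0 <= t <= 1 & C t 1 >]%:Z
    + sgz z2 * `[< exists2 t', 0 <= t' <= 1 & C 1 t' >]%:Z = `[< C tx tx' >]%:Z.
  rewrite -[RHS]/(`[< D sx sx' >]%:Z) -Cx; congr (_ * (nat_of_bool _)%:Z + _ * (nat_of_bool _)%:Z).
    by apply: asbool_eq; rewrite -exists_rev01 /D subr0.
  by apply: asbool_eq; rewrite -exists_rev01 /D subr0.
have xmax t t' : 0 <= t <= 1 -> 0 <= t' <= 1 -> Z t t' = 0 -> t <= tx /\ t' <= tx'.
  move=> t01 t'01 e; have [] := xmin (1 - t) (1 - t'); rewrite ?rev01 //.
    by move: e; rewrite /Z /affine2; lra.
  by rewrite /tx /tx'; split; lra.
have tx01 : 0 <= tx <= 1 by rewrite rev01.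
have tx'01 : 0 <= tx' <= 1 by rewrite rev01.
have Zxx : Z tx tx' = 0 by move: Zx; rewrite /Z /affine2 /tx /tx'; lra.
have [lex lex'] := emin _ _ tx01 tx'01 Zxx.
have bE : square_boundary te te'.
  rewrite /square_boundary te01 te'01 /=.
  by case/orP: teb => /eqP->; rewrite ltxx ?andbF.
have bX : square_boundary tx tx'.
  rewrite /square_boundary tx01 tx'01 /= /tx /tx'.
  by case/orP: sxb => /eqP->; rewrite subr0 ltxx ?andbF.
have zq : 0 < z1 ^+ 2 + z2 ^+ 2.
  case: (ltrgt0P z1) z1p => // h1 _; first by rewrite ltr_pwDl ?sqr_ge0 ?exprn_gt0.
  by rewrite ltr_pwDr ?sqr_ge0 ?exprn_gt0 //; lra.
have qn : z1 ^+ 2 + z2 ^+ 2 != 0 by rewrite gt_eqF.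
(* the line has direction (z2, z1); project onto it to find the parameter *)
have on_line t t' s s' : Z t t' = 0 -> Z s s' = 0 ->
    let l := ((s - t) * z2 + (s' - t') * z1) / (z1 ^+ 2 + z2 ^+ 2) in
    s = t + l * z2 /\ s' = t' + l * z1.
  move=> e e' l; have d : (s - t) * z1 = (s' - t') * z2.
    by move: e e'; rewrite /Z /affine2; lra.
  by split; apply: (mulIf qn); rewrite /l mulrDl mulrAC divfK //;
    [have := congr1 ( *%R^~ z1) d | have := congr1 ( *%R^~ z2) d]; move=> {}d; lra.
have [kx kx'] := on_line _ _ _ _ Ze Zxx.
set k := (_ / _) in kx kx'.
have k0 : 0 < k.
  rewrite lt_neqAle; apply/andP; split; last first.
    by rewrite divr_ge0 ?addr_ge0 ?sqr_ge0 ?mulr_ge0 ?subr_ge0.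
  apply/eqP=> k0; move: kx kx'; rewrite -k0 !mul0r !addr0 => kx kx'.
  have one0 : (1 : R) <> 0 by apply/eqP; rewrite oner_eq0.
  case/orP: sxb => /eqP sx0; case/orP: teb => /eqP te0.
  - by apply: one0; move: kx; rewrite /tx sx0 te0 subr0.
  - by move/eqP: c10; apply; rewrite -Ze -kx te0 /tx sx0; ring.
  - by move/eqP: c01; apply; rewrite -Ze -kx' te0 /tx' sx0; ring.
  - by apply: one0; move: kx'; rewrite /tx' sx0 te0 subr0.
have segX l : X (te + l * z2) (te' + l * z1) = X te te' + l * (z2 * x1 - z1 * x2).
  by rewrite /X /affine2; ring.
have segY l : Y (te + l * z2) (te' + l * z1) = Y te te' + l * (z2 * y1 - z1 * y2).
  by rewrite /Y /affine2; ring.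
have segZ l : Z (te + l * z2) (te' + l * z1) = 0.
  by rewrite -Ze /Z /affine2; ring.
have seg01 l : 0 <= l <= k -> 0 <= te + l * z2 <= 1 /\ 0 <= te' + l * z1 <= 1.
  case/andP=> l0 lk; case/andP: te01 => ? ?; case/andP: te'01 => ? ?.
  case/andP: tx01 => ? ?; case/andP: tx'01 => ? ?.
  have h1 : 0 <= l * z2 by rewrite mulr_ge0.
  have h2 : 0 <= l * z1 by rewrite mulr_ge0.
  have h3 : 0 <= (k - l) * z2 by rewrite mulr_ge0 // subr_ge0.
  have h4 : 0 <= (k - l) * z1 by rewrite mulr_ge0 // subr_ge0.
  by split; apply/andP; split; lra.
have inner (P : R -> R -> Prop) :
    (forall t t', square_boundary t t' -> P t t' -> Z t t' = 0 -> False) ->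
    (exists t t', [/\ 0 < t < 1, 0 < t' < 1 & P t t' /\ Z t t' = 0]) <->
    (exists2 l, 0 <= l <= k & P (te + l * z2) (te' + l * z1)).
  move=> Pb; split=> [[t [t' [t01 t'01 [Ptt e]]]]|[l lk Pl]].
    have [] := on_line _ _ _ _ Ze e; set l := (_ / _) => et et'.
    exists l; last by rewrite -et -et'.
    have [? ?] := emin _ _ (inS _ t01) (inS _ t'01) e.
    have [? ?] := xmax _ _ (inS _ t01) (inS _ t'01) e.
    rewrite divr_ge0 ?addr_ge0 ?sqr_ge0 ?mulr_ge0 ?subr_ge0 //=.
    by rewrite ler_pM2r ?invr_gt0 // lerD // ler_wpM2r // lerB.
  have [l1 l2] := seg01 _ lk.
  exists (te + l * z2), (te' + l * z1).
  have : ~~ square_boundary (te + l * z2) (te' + l * z1).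
    by apply/negP=> /Pb/(_ Pl (segZ l)).
  by rewrite /square_boundary l1 l2 /= negbK => /andP[].
have Eby := by_ _ _ bE; have Ebx := bx_ _ _ bE.
have Xby := by_ _ _ bX; have Xbx := bx_ _ _ bX.
have EX : X tx tx' = X te te' + k * (z2 * x1 - z1 * x2) by rewrite kx kx' segX.
have EY : Y tx tx' = Y te te' + k * (z2 * y1 - z1 * y2) by rewrite kx kx' segY.
have := @segment_crosses_rays R (X te te') (Y te te') (z2 * x1 - z1 * x2)
  (z2 * y1 - z1 * y2) k; rewrite -EX -EY => /(_ k0) main.
rewrite /square_degree.
have -> : sgz z1 * (`[< exists2 t, 0 <= t <= 1 & C t 1 >]%:Z
              - `[< exists2 t, 0 <= t <= 1 & C t 0 >]%:Z)
    + sgz z2 * (`[< exists2 t', 0 <= t' <= 1 & C 1 t' >]%:Z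
              - `[< exists2 t', 0 <= t' <= 1 & C 0 t' >]%:Z)
    = `[< C tx tx' >]%:Z - `[< C te te' >]%:Z.
  by rewrite -exitC -Ce; ring.
have Casb t t' : Z t t' = 0 -> `[< C t t' >] = (0 < X t t') && (0 < Y t t').
  by move=> e; apply/asboolP/andP => [[]|[]].
rewrite !Casb // -main.
- congr (_ * (nat_of_bool _)%:Z + _ * (nat_of_bool _)%:Z); apply: asbool_eq.
    have [i1 i2] := inner (fun t t' => 0 < X t t' /\ Y t t' = 0)
      (fun t t' b e e' => by_ _ _ b (conj (proj2 e) e')).
    split=> [[t [t' [h1 h2 [h3 h4 h5]]]]|[l l1]].
      have [|l l1] := i1; first by exists t, t'.
      by rewrite segX segY; exists l.
    by rewrite -segX -segY => h; have [|t [t' [? ? [[]]]]] := i2; [exists l | exists t, t'].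
  have [i1 i2] := inner (fun t t' => X t t' = 0 /\ 0 < Y t t')
    (fun t t' b e e' => bx_ _ _ b (conj (proj1 e) e')).
  split=> [[t [t' [h1 h2 [h3 h4 h5]]]]|[l l1]].
    have [|l l1] := i1; first by exists t, t'.
    by rewrite segX segY; exists l.
  by rewrite -segX -segY => h; have [|t [t' [? ? [[]]]]] := i2; [exists l | exists t, t'].
- by apply/eqP=> e; apply: Ebx.
- by apply/eqP=> e; apply: Eby.
- by apply/eqP=> e; apply: Xbx.
- by apply/eqP=> e; apply: Xby.
- move=> l lk [e e']; have [l1 l2] := seg01 _ lk.
  by apply: (off0 _ _ l1 l2); rewrite segX segY segZ.
Qed.
End Square.

Lemma square_boundary_rev1 (R : realFieldType) (t t' : R) :
  square_boundary (1 - t) t' = square_boundary t t'.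
Proof. by rewrite /square_boundary rev01 rev01_lt. Qed.

Lemma square_boundary_rev2 (R : realFieldType) (t t' : R) :
  square_boundary t (1 - t') = square_boundary t t'.
Proof. by rewrite /square_boundary rev01 rev01_lt. Qed.

Section SquareSymmetry.
Variables (R : realFieldType) (x0 x1 x2 y0 y1 y2 z0 z1 z2 : R).

Lemma square_generic_rev1 : square_generic x0 x1 x2 y0 y1 y2 z0 z1 z2 ->
  square_generic (x0 + x1) (- x1) x2 (y0 + y1) (- y1) y2 (z0 + z1) (- z1) z2.
Proof.
case=> [[c00 c10 c01 c11] by_ bx_ off0]; split=> [|t t'|t t'|t t' ht ht'].
- by rewrite !affine2_rev1 !subr0 !subrr; split.
- by rewrite !affine2_rev1 -square_boundary_rev1; exact: by_.
- by rewrite !affine2_rev1 -square_boundary_rev1; exact: bx_.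
- by rewrite !affine2_rev1; apply: off0; rewrite ?rev01.
Qed.

Lemma square_generic_rev2 : square_generic x0 x1 x2 y0 y1 y2 z0 z1 z2 ->
  square_generic (x0 - x2) x1 (- x2) (y0 - y2) y1 (- y2) (z0 - z2) z1 (- z2).
Proof.
case=> [[c00 c10 c01 c11] by_ bx_ off0]; split=> [|t t'|t t'|t t' ht ht'].
- by rewrite !affine2_rev2 !subr0 !subrr; split.
- by rewrite !affine2_rev2 -square_boundary_rev2; exact: by_.
- by rewrite !affine2_rev2 -square_boundary_rev2; exact: bx_.
- by rewrite !affine2_rev2; apply: off0; rewrite ?rev01.
Qed.

Lemma exists_rev1 (P : R -> R -> Prop) :
  (exists t t', [/\ 0 < t < 1, 0 < t' < 1 & P (1 - t) t']) <->
  (exists t t', [/\ 0 < t < 1, 0 < t' < 1 & P t t']).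
Proof.
split=> -[t [t' [t01 t'01 Pt]]]; exists (1 - t), t'; rewrite rev01_lt; split=> //.
by rewrite opprB addrC subrK.
Qed.

Lemma exists_rev2 (P : R -> R -> Prop) :
  (exists t t', [/\ 0 < t < 1, 0 < t' < 1 & P t (1 - t')]) <->
  (exists t t', [/\ 0 < t < 1, 0 < t' < 1 & P t t']).
Proof.
split=> -[t [t' [t01 t'01 Pt]]]; exists t, (1 - t'); rewrite rev01_lt; split=> //.
by rewrite opprB [1 + _]addrC subrK.
Qed.

(** Reversing the first parameter changes the sign of both sides. *)
Lemma square_degree_rev1 :
  square_degree (x0 + x1) (- x1) x2 (y0 + y1) (- y1) y2 (z0 + z1) (- z1) z2 ->
  square_degree x0 x1 x2 y0 y1 y2 z0 z1 z2.
Proof.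
have fe c0 c1 c2 : affine2 (c0 + c1) (- c1) c2 = fun t => affine2 c0 c1 c2 (1 - t).
  by apply: funext => t; apply: funext => t'; rewrite affine2_rev1.
rewrite /square_degree !fe.
set X := affine2 x0 x1 x2; set Y := affine2 y0 y1 y2; set Z := affine2 z0 z1 z2.
rewrite (asbool_eq (exists_rev1 (fun t t' => [/\ 0 < X t t', Y t t' = 0 & Z t t' = 0]))).
rewrite (asbool_eq (exists_rev1 (fun t t' => [/\ X t t' = 0, 0 < Y t t' & Z t t' = 0]))).
rewrite (asbool_eq (exists_rev01 (fun t => [/\ 0 < X t 1, 0 < Y t 1 & Z t 1 = 0]))).
rewrite (asbool_eq (exists_rev01 (fun t => [/\ 0 < X t 0, 0 < Y t 0 & Z t 0 = 0]))).
have eN a b : z2 * - a - - z1 * b = - (z2 * a - z1 * b) by ring.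
rewrite subrr subr0 !eN !sgzN => H.
by apply: oppr_inj; apply: etrans (etrans _ H) _; ring.
Qed.

Lemma square_degree_rev2 :
  square_degree (x0 - x2) x1 (- x2) (y0 - y2) y1 (- y2) (z0 - z2) z1 (- z2) ->
  square_degree x0 x1 x2 y0 y1 y2 z0 z1 z2.
Proof.
have fe c0 c1 c2 : affine2 (c0 - c2) c1 (- c2) = fun t t' => affine2 c0 c1 c2 t (1 - t').
  by apply: funext => t; apply: funext => t'; rewrite affine2_rev2.
rewrite /square_degree !fe.
set X := affine2 x0 x1 x2; set Y := affine2 y0 y1 y2; set Z := affine2 z0 z1 z2.
rewrite (asbool_eq (exists_rev2 (fun t t' => [/\ 0 < X t t', Y t t' = 0 & Z t t' = 0]))).
rewrite (asbool_eq (exists_rev2 (fun t t' => [/\ X t t' = 0, 0 < Y t t' & Z t t' = 0]))).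
rewrite (asbool_eq (exists_rev01 (fun t => [/\ 0 < X 1 t, 0 < Y 1 t & Z 1 t = 0]))).
rewrite (asbool_eq (exists_rev01 (fun t => [/\ 0 < X 0 t, 0 < Y 0 t & Z 0 t = 0]))).
have eN a b : - z2 * a - z1 * - b = - (z2 * a - z1 * b) by ring.
rewrite subrr subr0 !eN !sgzN => H.
by apply: oppr_inj; apply: etrans (etrans _ H) _; ring.
Qed.
End SquareSymmetry.

Lemma square_degreeP (R : realFieldType) (x0 x1 x2 y0 y1 y2 z0 z1 z2 : R) :
  square_generic x0 x1 x2 y0 y1 y2 z0 z1 z2 ->
  square_degree x0 x1 x2 y0 y1 y2 z0 z1 z2.
Proof.
have flip2 a0 a1 a2 b0 b1 b2 c0 c1 c2 : 0 <= c1 ->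
    square_generic a0 a1 a2 b0 b1 b2 c0 c1 c2 ->
    @square_degree R a0 a1 a2 b0 b1 b2 c0 c1 c2.
  move=> c1p; case: (leP 0 c2) => [c2p|c2n gen]; first exact: square_degree_pos.
  apply/square_degree_rev2/square_degree_pos => //; first by rewrite oppr_ge0 ltW.
  exact: square_generic_rev2.
case: (leP 0 z1) => [|z1n gen]; first exact: flip2.
apply/square_degree_rev1/flip2; first by rewrite oppr_ge0 ltW.
exact: square_generic_rev1.
Qed.

(** * Crossings of two sides and change of direction *)

Section Det3.
Variable R : realType.
Notation point := 'rV[R]_3.
Implicit Types u v w x y m : point.

Definition co u (k : nat) : R := u 0 (inord k).

Lemma co_ord u (j : 'I_3) : u 0 j = co u j.
Proof. by rewrite /co inord_val. Qed.

Lemma coD u v k : co (u + v) k = co u k + co v k. Proof. by rewrite /co mxE. Qed.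
Lemma coN u k : co (- u) k = - co u k. Proof. by rewrite /co mxE. Qed.
Lemma coZ a u k : co (a *: u) k = a * co u k. Proof. by rewrite /co mxE. Qed.
Lemma co0 k : co 0 k = 0. Proof. by rewrite /co mxE. Qed.
Definition coE := (coD, coN, coZ, co0).

Lemma co_inj u v : co u 0 = co v 0 -> co u 1 = co v 1 -> co u 2 = co v 2 -> u = v.
Proof.
move=> e0 e1 e2; apply/rowP => j; rewrite !co_ord.
by case: j => -[|[|[|]]] //= _.
Qed.

Lemma det3E u v w : det3 u v w =
  co u 0 * (co v 1 * co w 2 - co v 2 * co w 1)
  - co u 1 * (co v 0 * co w 2 - co v 2 * co w 0)
  + co u 2 * (co v 0 * co w 1 - co v 1 * co w 0).
Proof.
rewrite /det3 (expand_det_row _ ord0) !big_ord_recl big_ord0 /cofactor.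
rewrite !(expand_det_row _ ord0) !big_ord_recl !big_ord0 /cofactor !det_mx11.
by rewrite !mxE /= !co_ord /= /bump /=; ring.
Qed.

Lemma cramer3 v w m x : det3 v w m = 1 ->
  x = det3 x w m *: v + det3 v x m *: w + det3 v w x *: m.
Proof.
move=> d; apply: co_inj; rewrite !coE; rewrite -[LHS]mulr1 -d !det3E; ring.
Qed.

Lemma det3_affine1 w m x y z t t' :
  det3 (z + t *: x - t' *: y) w m
  = affine2 (det3 z w m) (det3 x w m) (det3 y w m) t t'.
Proof. by rewrite /affine2 !det3E !coE; ring. Qed.

Lemma det3_affine2 w m x y z t t' :
  det3 w (z + t *: x - t' *: y) m
  = affine2 (det3 w z m) (det3 w x m) (det3 w y m) t t'.
Proof. by rewrite /affine2 !det3E !coE; ring. Qed.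

Lemma det3_affine3 w m x y z t t' :
  det3 w m (z + t *: x - t' *: y)
  = affine2 (det3 w m z) (det3 w m x) (det3 w m y) t t'.
Proof. by rewrite /affine2 !det3E !coE; ring. Qed.

Lemma det3_12 v w m x y : det3 v w m = 1 ->
  det3 x y v = det3 v w y * det3 v x m - det3 v w x * det3 v y m.
Proof. by move=> d; rewrite -[LHS]mulr1 -d !det3E; ring. Qed.

Lemma det3_13 v w m x y : det3 v w m = 1 ->
  det3 x y w = - (det3 v w y * det3 x w m - det3 v w x * det3 y w m).
Proof. by move=> d; rewrite -[LHS]mulr1 -d !det3E; ring. Qed.

Lemma det3_swap_neg x y v : det3 y x v = det3 x y (- v).
Proof. by rewrite !det3E !coE; ring. Qed.

End Det3.

Section Arcs.
Variable R : realType.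
Notation point := 'rV[R]_3.
Notation side := (point * point)%type.
Implicit Types (u v w x : point) (s : side) (a b t : R).

Definition on_side s t : point := on_segment s.1 s.2 t.

Definition over_sign v s s' : int :=
  sgz (det3 (s.2 - s.1) (s'.2 - s'.1) v) * `[< Defs.over v s s' >]%:Z.

(** No end of one side is projected along [v] into the other side.  If the
projections cross, they therefore cross transversally, at interior points. *)
Definition misses v s s' : Prop :=
  forall t t' h, square_boundary t t' -> on_side s t <> on_side s' t' + h *: v.

Definition disjoint_sides s s' : Prop :=
  forall t t', 0 <= t <= 1 -> 0 <= t' <= 1 -> on_side s t <> on_side s' t'.

(** While the direction moves from [v] to [w], it meets no difference of two
ends; so it crosses the boundary of the parallelogram inside edges only. *)
Definition transverse v w s s' : Prop :=
  [/\ det3 v w (s.1 - s'.1) != 0, det3 v w (s.2 - s'.1) != 0,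
      det3 v w (s.1 - s'.2) != 0 & det3 v w (s.2 - s'.2) != 0].

Definition in_arc v w x : Prop :=
  exists a b : R, [/\ 0 < a, 0 < b & x = a *: v + b *: w].

(** The signed crossings of the sector between [v] and [w] with the edge of the
parallelogram of differences on which the second point is fixed at the vertex
[c]. *)
Definition arc_side v w s (c : point) : int :=
  sgz (det3 v w (s.2 - s.1))
  * `[< exists2 t, 0 <= t <= 1 & in_arc v w (on_side s t - c) >]%:Z.

(** As [arc_side], on an edge where the first point is fixed at [a]. *)
Definition arc_vertex v w (a : point) s : int :=
  sgz (det3 v w (s.2 - s.1))
  * `[< exists2 t, 0 <= t <= 1 & in_arc v w (a - on_side s t) >]%:Z.

Lemma on_side0 s : on_side s 0 = s.1.
Proof. by rewrite /on_side /on_segment subr0 scale1r scale0r addr0. Qed.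

Lemma on_side1 s : on_side s 1 = s.2.
Proof. by rewrite /on_side /on_segment subrr scale1r scale0r add0r. Qed.

Lemma on_sideB s s' t t' : on_side s t - on_side s' t'
  = (s.1 - s'.1) + t *: (s.2 - s.1) - t' *: (s'.2 - s'.1).
Proof. by apply: co_inj; rewrite /on_side /on_segment !coE; ring. Qed.

(** In the basis [v], [w] and a third vector, the points of the parallelogram
of differences on the ray of [v] are the crossings at which [s] passes over
[s'] in the projection along [v]; this is [square_degreeP]. *)
Lemma over_sign_diff v w s s' :
    transverse v w s s' -> misses v s s' -> misses w s s' -> disjoint_sides s s' ->
  over_sign v s s' - over_sign w s s'
  = arc_side v w s s'.2 - arc_side v w s s'.1
    + (arc_vertex v w s.2 s' - arc_vertex v w s.1 s').
Proof.
move=> [c00 c10 c01 c11] mv mw dis.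
have [m d] : exists m, det3 v w m = 1.
  exists ((det3 v w (s.1 - s'.1))^-1 *: (s.1 - s'.1)).
  have lin k x : det3 v w (k *: x) = k * det3 v w x by rewrite !det3E !coE; ring.
  by rewrite lin mulVf.
pose P t t' := on_side s t - on_side s' t'.
pose X t t' := det3 (P t t') w m.
pose Y t t' := det3 v (P t t') m.
pose Z t t' := det3 v w (P t t').
have PE t t' : P t t' = X t t' *: v + Y t t' *: w + Z t t' *: m by exact: cramer3.
have XE : X = affine2 (det3 (s.1 - s'.1) w m) (det3 (s.2 - s.1) w m) (det3 (s'.2 - s'.1) w m).
  by apply: funext=> t; apply: funext=> t'; rewrite /X /P on_sideB det3_affine1.
have YE : Y = affine2 (det3 v (s.1 - s'.1) m) (det3 v (s.2 - s.1) m) (det3 v (s'.2 - s'.1) m).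
  by apply: funext=> t; apply: funext=> t'; rewrite /Y /P on_sideB det3_affine2.
have ZE : Z = affine2 (det3 v w (s.1 - s'.1)) (det3 v w (s.2 - s.1)) (det3 v w (s'.2 - s'.1)).
  by apply: funext=> t; apply: funext=> t'; rewrite /Z /P on_sideB det3_affine3.
have unique (a b a' b' c c' : R) : a *: v + b *: w + c *: m = a' *: v + b' *: w + c' *: m ->
    [/\ a = a', b = b' & c = c'].
  move=> e.
  have e1 p q r : det3 (p *: v + q *: w + r *: m) w m = p.
    by rewrite -[RHS]mulr1 -d !det3E !coE; ring.
  have e2 p q r : det3 v (p *: v + q *: w + r *: m) m = q.
    by rewrite -[RHS]mulr1 -d !det3E !coE; ring.
  have e3 p q r : det3 v w (p *: v + q *: w + r *: m) = r.
    by rewrite -[RHS]mulr1 -d !det3E !coE; ring.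
  split; first by rewrite -(e1 a b c) e e1.
    by rewrite -(e2 a b c) e e2.
  by rewrite -(e3 a b c) e e3.
have arcE t t' : in_arc v w (P t t') <-> [/\ 0 < X t t', 0 < Y t t' & Z t t' = 0].
  rewrite {1}PE; split=> [[a [b [a0 b0]]]|[x0 y0 z0]].
    by rewrite -[RHS]addr0 -(scale0r m) => /unique[-> -> ->].
  by exists (X t t'), (Y t t'); rewrite x0 y0 z0 scale0r addr0.
have overv : Defs.over v s s' <-> exists t t', [/\ 0 < t < 1, 0 < t' < 1
      & [/\ 0 < X t t', Y t t' = 0 & Z t t' = 0]].
  split=> [[t [t' [h [t01 t'01 h0 /eqP]]]]|[t [t' [t01 t'01 [x0 y0 z0]]]]].
    rewrite addrC -subr_eq -/(P t t') PE => /eqP e.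
    exists t, t'; split=> //; have [] := @unique _ _ h 0 _ 0 (etrans e _) => [|-> -> ->] //.
    by rewrite !scale0r !addr0.
  exists t, t', (X t t'); split=> //; apply/eqP; rewrite addrC -subr_eq -/(P t t') PE.
  by rewrite y0 z0 !scale0r !addr0.
have overw : Defs.over w s s' <-> exists t t', [/\ 0 < t < 1, 0 < t' < 1
      & [/\ X t t' = 0, 0 < Y t t' & Z t t' = 0]].
  split=> [[t [t' [h [t01 t'01 h0 /eqP]]]]|[t [t' [t01 t'01 [x0 y0 z0]]]]].
    rewrite addrC -subr_eq -/(P t t') PE => /eqP e.
    exists t, t'; split=> //; have [] := @unique _ _ 0 h _ 0 (etrans e _) => [|-> -> ->] //.
    by rewrite !scale0r !addr0 add0r.
  exists t, t', (Y t t'); split=> //; apply/eqP; rewrite addrC -subr_eq -/(P t t') PE.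
  by rewrite x0 z0 !scale0r !addr0 add0r.
have gen : square_generic (det3 (s.1 - s'.1) w m) (det3 (s.2 - s.1) w m) (det3 (s'.2 - s'.1) w m)
    (det3 v (s.1 - s'.1) m) (det3 v (s.2 - s.1) m) (det3 v (s'.2 - s'.1) m)
    (det3 v w (s.1 - s'.1)) (det3 v w (s.2 - s.1)) (det3 v w (s'.2 - s'.1)).
  rewrite /square_generic -XE -YE -ZE; split=> [|t t' b [y0 z0]|t t' b [x0 z0]|t t' ht ht' [x0 y0 z0]].
  - by rewrite /Z /P !on_side0 !on_side1; split.
  - apply: (mv _ _ (X t t') b); apply/eqP; rewrite addrC -subr_eq -/(P t t') PE.
    by rewrite y0 z0 !scale0r !addr0.
  - apply: (mw _ _ (Y t t') b); apply/eqP; rewrite addrC -subr_eq -/(P t t') PE.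
    by rewrite x0 z0 !scale0r !addr0 add0r.
  - apply: (dis _ _ ht ht'); apply/eqP; rewrite -subr_eq0 -/(P t t') PE.
    by rewrite x0 y0 z0 !scale0r !addr0.
have := square_degreeP gen; rewrite /square_degree -XE -YE -ZE.
rewrite -(asbool_eq overv) -(asbool_eq overw).
rewrite -(det3_12 _ _ d) -[X in sgz X * (`[< Defs.over w s s' >])%:Z]opprK -(det3_13 _ _ d) sgzN mulNr => ->.
rewrite /arc_side /arc_vertex -!on_side0 -!on_side1 -!mulrBr.
congr (_ * (_%:Z - _%:Z) + _ * (_%:Z - _%:Z)); congr nat_of_bool; apply: asbool_eq;
  by split=> -[t t01 /arcE h]; exists t.
Qed.

End Arcs.

(** * Generic directions and linking numbers *)

Section Generic.
Variable R : realType.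
Notation point := 'rV[R]_3.
Implicit Types (u v w x : point) (a b t h : R).

Lemma exists_nonroot (p : {poly R}) : p != 0 -> exists r, ~~ root p r.
Proof.
move=> p0; pose rs : seq R := [seq i%:R | i <- iota 0 (size p)].
have urs : uniq rs by rewrite map_inj_uniq ?iota_uniq // => i j /eqP; rewrite eqr_nat => /eqP.
case: (boolP (all (root p) rs)) => [al|/allPn[x _ nx]]; last by exists x.
by have := max_poly_roots p0 al urs; rewrite size_map size_iota ltnn.
Qed.

(** Two vectors of a space of dimension 3 lie in a plane through the origin. *)
Lemma annihilator u v : exists2 n : point, n != 0 &
  forall a b, (a *: u + b *: v) *m n^T = 0.
Proof.
pose A := row_mx u^T v^T : 'M_(3, 1 + 1).
have : kermx A != 0.
  rewrite kermx_eq0 -row_leq_rank -ltnNge; apply: leq_ltn_trans (rank_leq_col A) _.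
  by [].
case/rowV0Pn=> n /sub_kermxP; rewrite mul_mx_row => e n0.
have [nu nv] : n *m u^T = 0 /\ n *m v^T = 0.
  by apply: eq_row_mx; rewrite e row_mx0.
exists n => // a b; apply: trmx_inj; rewrite trmx_mul trmxK linearD !linearZ /=.
by rewrite mulmxDr -!scalemxAr nu nv !scaler0 addr0 trmx0.
Qed.

(** The curve of all [(1, r, r ^ 2)] meets a plane through the origin in at most
two points, so finitely many planes do not cover it. *)
Lemma generic_direction (l : seq (point * point)) :
  exists w, forall p, p \in l -> forall a b, w <> a *: p.1 + b *: p.2.
Proof.
have ann (p : point * point) : {n : point | n != 0 & forall a b, (a *: p.1 + b *: p.2) *m n^T = 0}.
  by apply: cid2; case: (annihilator p.1 p.2) => n; exists n.
pose nu (p : point * point) : point := s2val (ann p).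
pose f (n : point) : {poly R} := \poly_(i < 3) co n i.
have f0 p : f (nu p) != 0.
  rewrite /nu; case: (ann p) => n /= n0 _; apply: contraNneq n0 => e.
  apply/eqP; apply: co_inj; rewrite co0; [have := coef0 R 0|have := coef0 R 1|have := coef0 R 2];
    by rewrite -e coef_poly.
pose F := \prod_(q <- [seq f (nu p) | p <- l]) q.
have : F != 0.
  by rewrite prodf_seq_neq0; apply/allP => q /mapP[p _ ->]; rewrite /= f0.
case/exists_nonroot=> r; rewrite root_bigmul => /allP nr.
exists (\row_i r ^+ i) => p pl a b e.
have /negP[] := nr _ (map_f (fun p => f (nu p)) pl).
have : ((\row_i r ^+ i) *m (nu p)^T) 0 0 = 0 :> R.
  by rewrite e /nu; case: (ann p) => n /= _ ->; rewrite mxE.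
rewrite mxE rootE horner_poly => e0; rewrite -[X in _ == X]e0; apply/eqP.
by apply: eq_bigr => i _; rewrite !mxE -co_ord mulrC.
Qed.

Lemma det3_neq0 u w x : u != 0 -> (forall a, x <> a *: u) ->
  (forall a b, w <> a *: u + b *: x) -> det3 u w x != 0.
Proof.
move=> u0 xu wux; apply/negP => /det0P[c c0].
have -> : c *m (\matrix_(i < 3) nth 0 [:: u; w; x] i)
    = co c 0 *: u + co c 1 *: w + co c 2 *: x.
  apply/rowP => j; rewrite !mxE !big_ord_recl big_ord0 !mxE !co_ord /= /bump /=; ring.
move=> e; case: (eqVneq (co c 1) 0) => [c1|c1]; last first.
  apply: (wux (- co c 0 / co c 1) (- co c 2 / co c 1)).
  have {1}-> : w = (co c 1)^-1 *: ((co c 0 *: u + co c 1 *: w + co c 2 *: x)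
      - co c 0 *: u - co c 2 *: x).
    by apply: co_inj; rewrite !coE; field.
  by rewrite e; apply: co_inj; rewrite !coE; field.
move: e; rewrite c1 scale0r addr0; case: (eqVneq (co c 2) 0) => [c2|c2].
  rewrite c2 scale0r addr0 => /eqP; rewrite scaler_eq0 (negbTE u0) orbF => /eqP c3.
  by move/negP: c0; apply; apply/eqP/co_inj; rewrite co0.
move/eqP; rewrite addrC addr_eq0 => /eqP e; apply: (xu (- co c 0 / co c 2)).
by apply: (scalerI c2); rewrite e scalerA mulrA [_ * - _]mulrC mulfK // scaleNr.
Qed.

End Generic.

Section LinkingNumber.
Variable R : realType.
Notation point := 'rV[R]_3.
Implicit Types (u v w x : point) (s : point * point) (K L : seq point).

(** Once [v] is generic, this is the linking number itself, and not twice it: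
only the crossings with [K] above are counted. *)
Definition total_over v K L : int :=
  \sum_(s <- sides K) \sum_(s' <- sides L) over_sign v s s'.

Definition generic_projection v K L : Prop :=
  forall s s', s \in sides K -> s' \in sides L -> misses v s s'.

Definition disjoint_polygons K L : Prop :=
  forall s s', s \in sides K -> s' \in sides L -> disjoint_sides s s'.

(** Boundary terms cancel along a closed polygon. *)
Lemma sum_sides_diff K (F : point -> int) :
  \sum_(s <- sides K) (F s.2 - F s.1) = 0.
Proof.
rewrite sumrB.
have -> : \sum_(s <- sides K) F s.2 = \sum_(x <- rot 1 K) F x.
  by rewrite -(big_map snd predT F) /sides -/unzip2 unzip2_zip // size_rot.
have -> : \sum_(s <- sides K) F s.1 = \sum_(x <- K) F x.
  by rewrite -(big_map fst predT F) /sides -/unzip1 unzip1_zip // size_rot.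
by rewrite (perm_big K) ?subrr //= perm_rot.
Qed.

Lemma boundary_cases (t t' : R) : square_boundary t t' ->
  [\/ t = 0, t = 1, t' = 0 | t' = 1].
Proof.
case/and3P=> /andP[a0 a1] /andP[b0 b1]; rewrite negb_and.
have edge (r : R) : 0 <= r -> r <= 1 -> ~~ (0 < r < 1) -> r = 0 \/ r = 1.
  move=> r0 r1; rewrite negb_and; case/orP; rewrite -leNgt => h.
    by left; apply/eqP; rewrite eq_le h r0.
  by right; apply/eqP; rewrite eq_le h r1.
case/orP=> /edge[] // ->; by [apply: Or41|apply: Or42|apply: Or43|apply: Or44].
Qed.

Definition corners s s' : seq point :=
  [:: s.1 - s'.1; s.2 - s'.1; s.1 - s'.2; s.2 - s'.2].

Definition corner_pairs s s' : seq (point * point) :=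
  [:: (s.1 - s'.1, s.1 - s'.2); (s.2 - s'.1, s.2 - s'.2);
      (s.1 - s'.1, s.2 - s'.1); (s.1 - s'.2, s.2 - s'.2)].

Lemma misses_generic w s s' : disjoint_sides s s' ->
  (forall p, p \in corner_pairs s s' -> forall a b : R, w <> a *: p.1 + b *: p.2) ->
  misses w s s'.
Proof.
move=> dis gen t t' h bd e.
have /and3P[t01 t'01 _] := bd.
have [h0|h0] := eqVneq h 0.
  by apply: (dis _ _ t01 t'01); rewrite e h0 scale0r addr0.
have {}e : w = h^-1 *: (on_side s t - on_side s' t').
  by rewrite e addrC addKr scalerA mulVf // scale1r.
have span p : p \in corner_pairs s s' ->
    (exists a b : R, on_side s t - on_side s' t' = a *: p.1 + b *: p.2) -> False.
  move=> /gen g [a [b ab]]; apply: (g (h^-1 * a) (h^-1 * b)).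
  by rewrite e ab scalerDr !scalerA.
case: (boundary_cases bd) => te; rewrite te in span; rewrite on_sideB in span.
- apply: (span (s.1 - s'.1, s.1 - s'.2)); rewrite ?inE ?eqxx ?orbT //=.
  by exists (1 - t'), t'; apply: co_inj; rewrite !coE; ring.
- apply: (span (s.2 - s'.1, s.2 - s'.2)); rewrite ?inE ?eqxx ?orbT //=.
  by exists (1 - t'), t'; apply: co_inj; rewrite !coE; ring.
- apply: (span (s.1 - s'.1, s.2 - s'.1)); rewrite ?inE ?eqxx ?orbT //=.
  by exists (1 - t), t; apply: co_inj; rewrite !coE; ring.
- apply: (span (s.1 - s'.2, s.2 - s'.2)); rewrite ?inE ?eqxx ?orbT //=.
  by exists (1 - t), t; apply: co_inj; rewrite !coE; ring.
Qed.

Lemma transverse_generic u w s s' : u != 0 -> misses u s s' ->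
  (forall x, x \in corners s s' -> forall a b : R, w <> a *: u + b *: x) ->
  transverse u w s s'.
Proof.
move=> u0 mu gen.
have corner (t t' a : R) : (t == 0) || (t == 1) -> (t' == 0) || (t' == 1) ->
    on_side s t - on_side s' t' <> a *: u.
  move=> ht ht' /eqP; rewrite subr_eq addrC => /eqP; apply: mu.
  by rewrite /square_boundary; case/orP: ht => /eqP->; case/orP: ht' => /eqP->;
    rewrite !lexx !ler01 !ltxx ?andbF.
split; apply: det3_neq0 => // [a|]; try (by apply: gen; rewrite !inE eqxx ?orbT).
- by rewrite -on_side0 -(on_side0 s'); apply: corner; rewrite eqxx ?orbT.
- by rewrite -on_side1 -(on_side0 s'); apply: corner; rewrite eqxx ?orbT.
- by rewrite -on_side0 -(on_side1 s'); apply: corner; rewrite eqxx ?orbT.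
- by rewrite -on_side1 -(on_side1 s'); apply: corner; rewrite eqxx ?orbT.
Qed.

Lemma total_over_arc v w K L : 
  (forall s s', s \in sides K -> s' \in sides L -> transverse v w s s') ->
  generic_projection v K L -> generic_projection w K L -> disjoint_polygons K L ->
  total_over v K L = total_over w K L.
Proof.
move=> cor gv gw dis; apply/eqP; rewrite -subr_eq0 -sumrB; apply/eqP.
under eq_big_seq => s sK.
  rewrite -sumrB.
  under eq_big_seq => s' sL.
    rewrite over_sign_diff; [over|exact: cor|exact: gv|exact: gw|exact: dis].
  rewrite big_split /= (sum_sides_diff L (arc_side v w s)) add0r.
  over.
rewrite exchange_big big1 // => s' _.
exact: (sum_sides_diff K (fun a => arc_vertex v w a s')).
Qed.

(** The sector between [v] and [v'] may contain differences of vertices, and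
[v'] may be [- v]; so the direction is moved through a generic third one. *)
Lemma total_over_indep v v' K L : v != 0 -> v' != 0 ->
  generic_projection v K L -> generic_projection v' K L -> disjoint_polygons K L ->
  total_over v K L = total_over v' K L.
Proof.
move=> v0 v'0 gv gv' dis.
pose bad s s' := corner_pairs s s' ++ [seq (v, x) | x <- corners s s'] ++ [seq (v', x) | x <- corners s s'].
have [w wgen] := generic_direction (flatten [seq bad s s' | s <- sides K, s' <- sides L]).
have {}wgen s s' p : s \in sides K -> s' \in sides L -> p \in bad s s' ->
    forall a b : R, w <> a *: p.1 + b *: p.2.
  by move=> sK sL pb; apply: wgen; apply/flattenP; exists (bad s s') => //; exact: allpairs_f.
have gw : generic_projection w K L.
  move=> s s' sK sL; apply: misses_generic; first exact: dis.
  by move=> p pe; apply: (wgen s s') => //; rewrite mem_cat pe.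
rewrite (@total_over_arc v w) // => [|s s' sK sL]; last first.
  apply: transverse_generic => //; first exact: gv.
  move=> x xc; apply: (wgen s s' (v, x) sK sL).
  by rewrite !mem_cat (map_f (fun x => (v, x)) xc) orbT.
apply/esym/total_over_arc => // s s' sK sL.
apply: transverse_generic => //; first exact: gv'.
move=> x xc; apply: (wgen s s' (v', x) sK sL).
by rewrite !mem_cat (map_f (fun x => (v', x)) xc) !orbT.
Qed.

(** Looking from behind exchanges over and under. *)
Lemma over_opp v s s' : Defs.over v s' s <-> Defs.over (- v) s s'.
Proof.
by split=> -[t [t' [h [t01 t'01 h0 e]]]]; exists t', t, h; split=> //;
  rewrite e ?scalerN ?addrK ?subrK.
Qed.

Lemma over_sign_opp v s s' : over_sign v s' s = over_sign (- v) s s'.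
Proof. by rewrite /over_sign det3_swap_neg (asbool_eq (over_opp v s s')). Qed.

Lemma misses_opp v s s' : misses v s s' -> misses (- v) s s'.
Proof. by move=> mv t t' h bd; rewrite scalerN -scaleNr; exact: mv. Qed.

(** A segment is convex: between a point at which [s] is above [s'] and one at
which it is below, the two would meet. *)
Lemma not_over_both v s s' : disjoint_sides s s' ->
  Defs.over v s s' -> Defs.over v s' s -> False.
Proof.
move=> dis [t1 [t1' [h [t101 t1'01 h0 e1]]]] [t2' [t2 [h' [t2'01 t201 h'0 e2]]]].
have hh : 0 < h + h' by rewrite addr_gt0.
(* the weights balance the heights h and - h' *)
pose l := h' / (h + h').
have l01 : 0 < l < 1.
  by rewrite divr_gt0 //= ltr_pdivrMr // mul1r ltrDr.
have conv (r1 r2 : R) : 0 < r1 < 1 -> 0 < r2 < 1 -> 0 <= l * r1 + (1 - l) * r2 <= 1.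
  case/andP: l01 => l0 l1 /andP[a0 a1] /andP[b0 b1].
  by apply/andP; split; nra.
apply: (dis (l * t1 + (1 - l) * t2) (l * t1' + (1 - l) * t2')); rewrite ?conv //.
have lin (p : point * point) (r1 r2 : R) : on_side p (l * r1 + (1 - l) * r2)
    = l *: on_segment p.1 p.2 r1 + (1 - l) *: on_segment p.1 p.2 r2.
  by apply: co_inj; rewrite /on_side /on_segment !coE; ring.
rewrite !lin e1 e2.
have lh : l * h = (1 - l) * h' by rewrite /l; field; rewrite gt_eqF.
by apply: co_inj; rewrite !coE; ring: lh.
Qed.

Lemma crossing_signE v s s' : disjoint_sides s s' ->
  crossing_sign v s s' = over_sign v s s' + over_sign (- v) s s'.
Proof.
move=> dis; rewrite -over_sign_opp /crossing_sign /over_sign.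
case: asboolP => [o|no]; case: asboolP => [o'|no'].
- by case: (not_over_both dis o o').
- by rewrite mulr1 mulr0 addr0.
- by rewrite mulr1 mulr0 add0r.
- by rewrite !mulr0.
Qed.

Lemma regular_generic v K L : regular_direction K L v <->
  v <> 0 /\ generic_projection v K L.
Proof.
have u1 (M : seq point) : map fst (sides M) = M.
  by rewrite /sides -/unzip1 unzip1_zip // size_rot.
have u2 (M : seq point) : map snd (sides M) = rot 1 M.
  by rewrite /sides -/unzip2 unzip2_zip // size_rot.
have mem1 (M : seq point) (s : point * point) : s \in sides M -> s.1 \in M.
  by move=> sM; rewrite -(u1 M) map_f.
have mem2 (M : seq point) (s : point * point) : s \in sides M -> s.2 \in M.
  by move=> sM; rewrite -(mem_rot 1) -(u2 M) map_f.
have start (M : seq point) (a : point) : a \in M -> exists2 s, s \in sides M & a = s.1.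
  by rewrite -{1}(u1 M) => /mapP.
split=> [[v0 rK rL]|[v0 gv]].
  split=> // s s' sK sL t t' h bd.
  have /and3P[t01 t'01 _] := bd.
  case: (boundary_cases bd) => ->.
  - by rewrite on_side0; apply: rK; rewrite ?mem1.
  - by rewrite on_side1; apply: rK; rewrite ?mem2.
  - move=> e; apply: (rL s'.1 s t (- h)); rewrite ?mem1 //.
    by rewrite scaleNr -/(on_side s t) e on_side0 addrK.
  - move=> e; apply: (rL s'.2 s t (- h)); rewrite ?mem2 //.
    by rewrite scaleNr -/(on_side s t) e on_side1 addrK.
split=> // a s t h.
  case/start=> s0 s0K -> sL t01; rewrite -on_side0; apply: (gv _ _ s0K sL 0 t h).
  by rewrite /square_boundary t01 lexx ler01 ltxx.
case/start=> s0 s0L -> sK t01 e; apply: (gv _ _ sK s0L t 0 (- h)).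
  by rewrite /square_boundary t01 lexx ler01 ltxx andbF.
by rewrite on_side0 e scaleNr addrK.
Qed.

(** Crossings with [L] above are crossings with [K] above for [- v], so that the
total of the crossing signs is [total_over v K L + total_over (- v) K L]. *)
Lemma linking_numberE v K L : v != 0 ->
  generic_projection v K L -> disjoint_polygons K L ->
  linking_number K L = total_over v K L.
Proof.
move=> v0 gv dis; rewrite /linking_number.
set v1 := classical_sets.xget _ _.
have /regular_generic[/eqP v10 gv1] : regular_direction K L v1.
  by apply: classical_sets.xgetPex; exists v; apply/regular_generic; split=> //; exact/eqP.
have -> : \sum_(s <- sides K) \sum_(s' <- sides L) crossing_sign v1 s s'
    = total_over v1 K L + total_over (- v1) K L.
  rewrite /total_over -big_split; apply: eq_big_seq => s sK.
  rewrite -big_split; apply: eq_big_seq => s' sL /=.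
  by rewrite crossing_signE //; exact: dis.
have gv1N : generic_projection (- v1) K L.
  by move=> s s' sK sL; apply: misses_opp; exact: gv1.
rewrite (@total_over_indep (- v1) v) ?oppr_eq0 // (@total_over_indep v1 v) //.
by rewrite -mulr2n -[_ *+ 2]mulr_natr; exact: mulzK.
Qed.

Lemma total_over_sym v K L : v != 0 ->
  generic_projection v K L -> disjoint_polygons K L ->
  total_over v L K = total_over v K L.
Proof.
move=> v0 gv dis; rewrite [LHS]exchange_big -(@total_over_indep (- v) v K L) ?oppr_eq0 //.
  by apply: eq_bigr => s _; apply: eq_bigr => s' _; rewrite over_sign_opp.
by move=> s s' sK sL; apply: misses_opp; exact: gv.
Qed.
End LinkingNumber.

(** * Turning the direction by a half-turn *)

Section HalfPlane.
Variable R : realType.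
Notation point := 'rV[R]_3.
Implicit Types (u v x c : point) (s : point * point).

(** The direction turns from [v] to [- v] through [u], so the sector becomes the
half-plane bounded by the line of [v] which contains [u].  With [u] pointing
upwards, the crossings counted are those where [c] lies below [s]. *)
Definition half_side v u s c : int := arc_side v u s c + arc_side u (- v) s c.
(** Here, [c] lies above [s]. *)
Definition half_vertex v u c s : int := arc_vertex v u c s + arc_vertex u (- v) c s.

Lemma det3_rot v u x : det3 u (- v) x = det3 v u x.
Proof. by rewrite !det3E !coE; ring. Qed.

(** The vertical line through [c] meets [s], above or below [c], exactly if the
linear form [det3 v u] takes the value at [c] between the ends of [s]. *)
Lemma half_vertex_side v u s c :
    det3 v u (s.1 - c) != 0 -> det3 v u (s.2 - c) != 0 ->
    (forall t h, 0 <= t <= 1 -> on_side s t - c <> h *: v) ->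
    (forall t h, 0 <= t <= 1 -> on_side s t - c <> h *: u) ->
  half_side v u s c + half_vertex v u c s
  = (det3 v u c < det3 v u s.2)%R%:Z - (det3 v u c < det3 v u s.1)%R%:Z.
Proof.
move=> n1 n2 mv mu.
have xiB x y : det3 v u (x - y) = det3 v u x - det3 v u y by rewrite !det3E !coE; ring.
rewrite -![det3 v u c < _]subr_gt0 -!xiB.
have xit t : det3 v u (on_side s t - c) =
    det3 v u (s.1 - c) + t * (det3 v u (s.2 - c) - det3 v u (s.1 - c)).
  by rewrite /on_side /on_segment !det3E !coE; ring.
rewrite /half_side /half_vertex /arc_side /arc_vertex !det3_rot -!mulrDr.
have -> : det3 v u (s.2 - s.1) = det3 v u (s.2 - c) - det3 v u (s.1 - c).
  by rewrite !xiB; ring.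
set a := det3 v u (s.1 - c) in n1 xit *; set b := det3 v u (s.2 - c) in n2 xit *.
have arc0 x : in_arc v u x -> det3 v u x = 0.
  by case=> p [q [_ _ ->]]; rewrite !det3E !coE; ring.
have arc0' x : in_arc u (- v) x -> det3 v u x = 0.
  by case=> p [q [_ _ ->]]; rewrite !det3E !coE; ring.
have xiN x : det3 v u (c - x) = - det3 v u (x - c) by rewrite !det3E !coE; ring.
case: (boolP (a * b < 0)) => [ab|nab]; last first.
  have no t : 0 <= t <= 1 -> a + t * (b - a) <> 0.
    case/andP=> t0 t1 e; move/negP: nab; apply.
    rewrite lt_neqAle mulf_neq0 //=.
    have -> : a * b = a * b - (a + b) * (a + t * (b - a)) + (a + t * (b - a)) ^+ 2.
      by rewrite e; ring.
    have -> : a * b - (a + b) * (a + t * (b - a)) + (a + t * (b - a)) ^+ 2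
        = - (t * (1 - t) * (a - b) ^+ 2) by ring.
    by rewrite oppr_le0 mulr_ge0 ?sqr_ge0 // mulr_ge0 // subr_ge0.
  rewrite !asboolF.
  - rewrite !mulr0; move: nab; case: (ltrgt0P a) n1 => // ha _; case: (ltrgt0P b) n2 => // hb _ //.
    + by rewrite nmulr_llt0 ?ha // pmulr_rlt0 // hb.
    + by rewrite nmulr_rlt0 // hb.
  - by case=> t /no nt /arc0' /eqP; rewrite xiN oppr_eq0 xit => /eqP.
  - by case=> t /no nt /arc0 /eqP; rewrite xiN oppr_eq0 xit => /eqP.
  - by case=> t /no nt /arc0'; rewrite xit.
  - by case=> t /no nt /arc0; rewrite xit.
have ba : b - a != 0 by rewrite subr_eq0; apply: contraTneq ab => ->; rewrite -leNgt -expr2 sqr_ge0.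
(* the point of the side on the vertical line through c *)
pose t0 := - a / (b - a).
have rt t : (a + t * (b - a) = 0) <-> t = t0.
  split=> [e|->]; last by rewrite /t0 divfK // subrr.
  by apply: (mulIf ba); rewrite /t0 divfK //; lra.
have t001 : 0 <= t0 <= 1.
  rewrite /t0; case: (ltrgt0P a) n1 ab => // ha _.
    rewrite pmulr_rlt0 // => hb.
    have hba : b - a < 0 by lra.
    by rewrite ler_ndivlMr // ler_ndivrMr // mul0r mul1r; apply/andP; split; lra.
  rewrite nmulr_rlt0 // => hb.
  have hba : 0 < b - a by lra.
  by rewrite ler_pdivlMr // ler_pdivrMr // mul0r mul1r; apply/andP; split; lra.
set q := on_side s t0 - c.
have xq : det3 v u q = 0 by rewrite xit; apply/rt.
have [m d] : exists m, det3 v u m = 1.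
  exists (a^-1 *: (s.1 - c)).
  have lin k x : det3 v u (k *: x) = k * det3 v u x by rewrite !det3E !coE; ring.
  by rewrite lin mulVf.
pose al := det3 q u m; pose be := det3 v q m.
have qE : q = al *: v + be *: u by rewrite {1}(cramer3 q d) xq scale0r addr0.
have al0 : al != 0.
  by apply/eqP=> e; apply: (mu t0 be t001); rewrite -/q qE e scale0r add0r.
have be0 : be != 0.
  by apply/eqP=> e; apply: (mv t0 al t001); rewrite -/q qE e scale0r addr0.
have unique (p r p' r' : R) : p *: v + r *: u = p' *: v + r' *: u -> p = p' /\ r = r'.
  move=> e.
  have e1 k l : det3 (k *: v + l *: u) u m = k by rewrite -[RHS]mulr1 -d !det3E !coE; ring.
  have e2 k l : det3 v (k *: v + l *: u) m = l by rewrite -[RHS]mulr1 -d !det3E !coE; ring.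
  by split; [rewrite -(e1 p r) e e1 | rewrite -(e2 p r) e e2].
have at0 (P : point -> Prop) : (forall x, P x -> det3 v u x = 0) ->
    `[< exists2 t, 0 <= t <= 1 & P (on_side s t - c) >] = `[< P q >].
  move=> P0; apply: asbool_eq; split=> [[t _ Pt]|Pq]; last by exists t0.
  by have /rt e : a + t * (b - a) = 0 by [rewrite -xit; exact: P0]; rewrite /q -e.
have at0N (P : point -> Prop) : (forall x, P x -> det3 v u x = 0) ->
    `[< exists2 t, 0 <= t <= 1 & P (c - on_side s t) >] = `[< P (- q) >].
  move=> P0; rewrite -(at0 (fun x => P (- x))); last first.
    by move=> x /P0 e; apply: oppr_inj; rewrite oppr0 -[RHS]e !det3E !coE; ring.
  by apply: asbool_eq; split=> -[t t01 Pt]; exists t => //; move: Pt; rewrite ?opprB.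
have arcE (p r : R) : `[< in_arc v u (p *: v + r *: u) >] = (0 < p) && (0 < r).
  apply/asboolP/andP=> [[p' [r' [p0 r0 /unique[-> ->]]]]|[p0 r0]] //.
  by exists p, r.
have arcE' (p r : R) : `[< in_arc u (- v) (p *: v + r *: u) >] = (p < 0) && (0 < r).
  apply/asboolP/andP=> [[p' [r' [p0 r0]]]|[p0 r0]].
    by rewrite scalerN -scaleNr [X in _ = X -> _]addrC => /unique[-> ->]; rewrite oppr_lt0.
  by exists r, (- p); split; rewrite ?oppr_gt0 // scalerN scaleNr opprK addrC.
rewrite (at0 _ arc0) (at0 _ arc0') (at0N _ arc0) (at0N _ arc0').
have -> : - q = (- al) *: v + (- be) *: u by rewrite qE opprD !scaleNr.
rewrite qE !arcE !arcE' !oppr_gt0 !oppr_lt0.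
have -> : ((0 < al) && (0 < be))%:Z + ((al < 0) && (0 < be))%:Z
   + (((al < 0) && (be < 0))%:Z + ((0 < al) && (be < 0))%:Z) = 1.
  by case: (ltrgt0P al) al0 => // _ _; case: (ltrgt0P be) be0.
rewrite mulr1; case: (ltrgt0P a) n1 ab => // ha _.
  rewrite pmulr_rlt0 // => hb; rewrite ltr0_sgz; last by lra.
  by rewrite (ltNge 0 b) ltW.
rewrite nmulr_rlt0 // => hb; rewrite gtr0_sgz; last by lra.
by rewrite hb.
Qed.

(** Apply [over_sign_diff] on the way from [v] to [u] and from [u] to [- v]. *)
Lemma over_sign_half v u s s' :
    transverse v u s s' -> misses v s s' -> misses u s s' -> disjoint_sides s s' ->
  over_sign v s s' - over_sign v s' s
  = half_side v u s s'.2 - half_side v u s s'.1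
    + (half_vertex v u s.2 s' - half_vertex v u s.1 s').
Proof.
move=> cor mv mu dis; rewrite [over_sign v s' s]over_sign_opp.
have -> : over_sign v s s' - over_sign (- v) s s'
   = (over_sign v s s' - over_sign u s s') + (over_sign u s s' - over_sign (- v) s s').
  by ring.
rewrite (over_sign_diff cor mv mu dis) over_sign_diff //; first last.
- exact: misses_opp.
- by rewrite /transverse !det3_rot.
by rewrite /half_side /half_vertex; ring.
Qed.

Lemma on_side_swap s t : on_side (s.2, s.1) t = on_side s (1 - t).
Proof. by apply: co_inj; rewrite /on_side /on_segment !coE /=; ring. Qed.

Lemma over_sign_swap v s s' : over_sign v (s.2, s.1) s' = - over_sign v s s'.
Proof.
rewrite /over_sign /=.
have -> : det3 (s.1 - s.2) (s'.2 - s'.1) v = - det3 (s.2 - s.1) (s'.2 - s'.1) v.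
  by rewrite !det3E !coE; ring.
rewrite sgzN mulNr; congr (- (_ * (nat_of_bool _)%:Z)); apply: asbool_eq.
split=> -[t [t' [h [t01 t'01 h0 e]]]]; exists (1 - t), t', h; split; rewrite ?rev01_lt // -e.
  by rewrite -/(on_side (s.2, s.1) t) on_side_swap.
by rewrite -/(on_side (s.2, s.1) (1 - t)) on_side_swap /on_side; congr on_segment; ring.
Qed.

Lemma over_sign_swapr v s s' : over_sign v s (s'.2, s'.1) = - over_sign v s s'.
Proof. by rewrite !(over_sign_opp v _ s) over_sign_swap. Qed.

End HalfPlane.

Section PathSides.
Variable R : realType.
Notation point := 'rV[R]_3.
Implicit Types (P Q : seq point) (x y : point).

Lemma path_sides_cat P Q x :
  path_sides (P ++ x :: Q) = path_sides (rcons P x) ++ path_sides (x :: Q).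
Proof.
elim: P => [|y P IH] //=; case: P IH => [|z P] //= IH.
by rewrite /path_sides /= in IH *; rewrite IH.
Qed.

Lemma path_sides_rev P : path_sides (rev P) = rev [seq (s.2, s.1) | s <- path_sides P].
Proof.
elim: P => [|x P IH] //; case: P IH => [|y P] // IH.
rewrite !rev_cons -!cats1 -catA path_sides_cat cats1 -rev_cons IH.
by rewrite -[RHS]cats1.
Qed.
End PathSides.

(** * Linking numbers in a spatial complete graph *)

Section GenericPair.
Variable R : realType.
Notation point := 'rV[R]_3.

Lemma generic_pair (A : seq (point * point)) : exists v u : point, v != 0 /\
  forall s s', s \in A -> s' \in A -> disjoint_sides s s' ->
    [/\ misses v s s', misses u s s' & transverse v u s s'].
Proof.
have [v vgen] := generic_direction ((0, 0) :: flatten [seq corner_pairs s s' | s <- A, s' <- A]).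
have v0 : v != 0.
  apply/eqP=> v0; apply: (vgen (0, 0) _ 0 0); first exact: mem_head.
  by rewrite v0 !scale0r addr0.
have [u ugen] := generic_direction
  (flatten [seq corner_pairs s s' ++ [seq (v, x) | x <- corners s s'] | s <- A, s' <- A]).
exists v, u; split=> // s s' sA s'A dis.
have mv : misses v s s'.
  apply: misses_generic => // p pe; apply: vgen; rewrite inE; apply/orP; right.
  by apply/flattenP; exists (corner_pairs s s') => //; exact: allpairs_f.
have {}ugen p : p \in corner_pairs s s' ++ [seq (v, x) | x <- corners s s'] ->
    forall a b : R, u <> a *: p.1 + b *: p.2.
  move=> pe; apply: ugen; apply/flattenP; eexists; last exact: pe.
  exact: (allpairs_f (fun s s' => corner_pairs s s' ++ [seq (v, x) | x <- corners s s'])).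
split=> //; first by apply: misses_generic => // p pe; apply: ugen; rewrite mem_cat pe.
apply: transverse_generic => // x xc; apply: (ugen (v, x)).
by rewrite mem_cat (map_f (fun x => (v, x)) xc) orbT.
Qed.

(** The analogue of [sum_sides_diff] for open paths, where the two ends remain. *)
Lemma path_telescope (F : point -> int) (x y : point) P :
  \sum_(s <- path_sides (x :: rcons P y)) (F s.2 - F s.1) = F y - F x.
Proof.
elim: P x => [|z P IH] x; first by rewrite /path_sides /= big_seq1.
rewrite rcons_cons -[path_sides _]/((x, z) :: path_sides (z :: rcons P y)).
by rewrite big_cons IH /=; ring.
Qed.

Lemma path_sides_first (x y : point) P :
  exists2 s, s \in path_sides (x :: rcons P y) & s.1 = x.
Proof. by case: P => [|z P]; [exists (x, y)|exists (x, z)]; rewrite // inE eqxx. Qed.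

Lemma path_sides_last (x y : point) P :
  exists2 s, s \in path_sides (x :: rcons P y) & s.2 = y.
Proof.
elim: P x => [|z P IH] x; first by exists (x, y); rewrite // inE eqxx.
by have [s sP e] := IH z; exists s => //; rewrite rcons_cons inE sP orbT.
Qed.
End GenericPair.

Lemma map_next (T : eqType) (s : seq T) : uniq s -> [seq next s x | x <- s] = rot 1 s.
Proof.
case: s => // y p us; have ux := us; apply: (@eq_from_nth _ y); first by rewrite size_map size_rot.
move=> i; rewrite size_map => lis; rewrite (nth_map y) // next_nth mem_nth // index_uniq //.
rewrite rot1_cons nth_rcons; case: ltngtP => // [h|->]; last by rewrite nth_default.
by rewrite nth_default // ltnW.
Qed.

Lemma zip_next (T : eqType) (s : seq T) : uniq s ->
  [seq (x, next s x) | x <- s] = zip s (rot 1 s).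
Proof.
move=> us; rewrite -(map_next us); move: (next s) => F {us}.
by elim: s => //= x r ->.
Qed.

Section Embedding.
Variables (R : realType) (T : finType) (e : rel T) (f : spatial_embedding R e).
Notation point := 'rV[R]_3.
Implicit Types (x y z w : T).

Definition edge_sides x y := path_sides (edge_path (pos f) (brk f) x y).

(** The polygon of a cycle is the concatenation of the paths of its edges, so
sums over its sides are sums over the edges of the cycle. *)
Lemma sides_cycle_image (s : seq T) : uniq s ->
  sides (cycle_image f s) = flatten [seq edge_sides p.1 p.2 | p <- zip s (rot 1 s)].
Proof.
move=> us; rewrite /cycle_image.
have -> : [seq pos f x :: brk f x (next s x) | x <- s]
    = [seq pos f p.1 :: brk f p.1 p.2 | p <- zip s (rot 1 s)].
  by rewrite -zip_next // -map_comp.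
case: s us => [|x0 r] _ //; rewrite rot1_cons.
set P := flatten _.
have -> : sides P = path_sides (rcons P (pos f x0)).
  have [Q ->] : exists Q, P = pos f x0 :: Q by rewrite /P; case: (r) => [|y r'] /=; eexists.
  rewrite /sides rot1_cons /path_sides rcons_cons /=; set C := rcons Q _.
  have -> : pos f x0 :: C = (pos f x0 :: Q) ++ [:: pos f x0] by rewrite /C -cats1.
  by rewrite -[X in _ = zip _ X]cats0 zip_cat ?cats0 // /C size_rcons.
rewrite /P {P}; move: {2 3 5}x0 => y; elim: r x0 => [|z r IH] x /=.
  by rewrite !cats0.
rewrite -rcons_cons -cat_cons rcons_cat -IH.
set rest := flatten _.
have [Q ->] : exists Q, rest = pos f z :: Q.
  by rewrite /rest; case: (r) => [|z' r'] /=; eexists.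
by rewrite rcons_cons path_sides_cat rcons_cons.
Qed.

Lemma edge_sides_rev x y : e x y ->
  edge_sides y x = rev [seq (s.2, s.1) | s <- edge_sides x y].
Proof.
move=> exy; rewrite -path_sides_rev /edge_sides /edge_path (brk_sym f exy).
by rewrite rev_cons rev_rcons.
Qed.

Lemma sum_edge_sides_rev (F : point * point -> int) x y : e x y ->
  (forall s, F (s.2, s.1) = - F s) ->
  \sum_(s <- edge_sides y x) F s = - \sum_(s <- edge_sides x y) F s.
Proof.
move=> exy FN; rewrite edge_sides_rev // (perm_big _ (permEl (perm_rev _))) big_map.
by rewrite -sumrN; apply: eq_bigr => s _; rewrite FN.
Qed.

Lemma disjoint_edge_sides x y z w s s' : e x y -> e z w ->
  [disjoint [set x; y] & [set z; w]] ->
  s \in edge_sides x y -> s' \in edge_sides z w -> disjoint_sides s s'.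
Proof.
move=> exy ezw dis sxy szw t t' t01 t'01 eq.
have ne : [set x; y] != [set z; w].
  apply: contraTneq dis => ->; rewrite -setI_eq0 setIid.
  by apply/set0Pn; exists z; rewrite !inE eqxx.
have [||q] := @edge_edge _ _ _ f _ _ _ _ (on_side s t) exy ezw ne.
- by exists s => //; exists t.
- by exists s' => //; exists t'.
by move: dis; rewrite -setI_eq0 => /eqP ->; rewrite inE.
Qed.

Definition edge_over v x y z w : int :=
  \sum_(s <- edge_sides x y) \sum_(s' <- edge_sides z w) over_sign v s s'.

Lemma edge_over_swap v x y z w : e x y ->
  edge_over v y x z w = - edge_over v x y z w.
Proof.
move=> exy; rewrite /edge_over.
apply: (@sum_edge_sides_rev (fun s => \sum_(s' <- edge_sides z w) over_sign v s s')) => // s.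
by rewrite -sumrN; apply: eq_bigr => s' _; rewrite over_sign_swap.
Qed.

Lemma edge_over_swapr v x y z w : e z w ->
  edge_over v x y w z = - edge_over v x y z w.
Proof.
move=> ezw; rewrite /edge_over -sumrN; apply: eq_bigr => s _.
by apply: sum_edge_sides_rev => // s'; rewrite over_sign_swapr.
Qed.

Definition half_vertex_edge v u c x y : int :=
  \sum_(s <- edge_sides x y) half_vertex v u (pos f c) s.

(** [v] is the direction of projection, and [u] the upward direction in the
plane of projection. *)
Definition generic_for_edges v u : Prop :=
  forall x y z w s s', e x y -> e z w -> [disjoint [set x; y] & [set z; w]] ->
    s \in edge_sides x y -> s' \in edge_sides z w ->
    [/\ misses v s s', misses u s s' & transverse v u s s'].

Lemma generic_pair_embedding : exists v u : point, v != 0 /\ generic_for_edges v u.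
Proof.
pose A := flatten [seq edge_sides p.1 p.2 | p <- enum {: T * T}].
have [v [u [v0 vu]]] := generic_pair A.
exists v, u; split=> // x y z w s s' exy ezw dis sxy szw.
have inA a b r : r \in edge_sides a b -> r \in A.
  move=> rab; apply/flattenP; exists (edge_sides a b) => //.
  by apply/mapP; exists (a, b); rewrite ?mem_enum.
by apply: vu; [apply: inA sxy | apply: inA szw | apply: disjoint_edge_sides sxy szw].
Qed.

End Embedding.

Section CompleteGraph.
Variables (R : realType) (n : nat) (f : spatial_embedding R (@complete n)).
Notation point := 'rV[R]_3.
Variables (v u : point).
Hypothesis v0 : v != 0.
Hypothesis gen : generic_for_edges f v u.

(** Horizontal coordinate in the projection along [v] if [u] points upwards. *)
Definition abscissa (x : 'I_n) : R := det3 v u (pos f x).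

(** The signed indicator that the vertical line through [c] separates [x] from
[y]. *)
Definition before (c x y : 'I_n) : int :=
  (abscissa c < abscissa y)%R%:Z - (abscissa c < abscissa x)%R%:Z.

Lemma disjoint_pairs (x y z w : 'I_n) :
  [disjoint [set x; y] & [set z; w]] = [&& x != z, x != w, y != z & y != w].
Proof.
rewrite -setI_eq0; apply/eqP/and4P => [d|[a b c d]].
  split; apply/eqP=> eq; have := in_set0 x; have := in_set0 y;
  by rewrite -d !inE ?eq !eqxx ?orbT ?andbT //= eq !eqxx ?orbT.
apply/setP=> q; rewrite !inE; apply/andP => -[/orP[]/eqP-> /orP[]/eqP eq];
 by rewrite eq eqxx in a b c d.
Qed.

Lemma uniq4 (x y z w : 'I_n) : uniq [:: x; y; z; w] ->
  [/\ complete x y, complete z w & [disjoint [set x; y] & [set z; w]]].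
Proof.
rewrite disjoint_pairs /= !inE !negb_or => /and4P[/and3P[xy xz xw] /andP[yz yw] zw _].
by split=> //; apply/and4P.
Qed.

Lemma abscissa_inj : (4 <= n)%N -> injective abscissa.
Proof.
move=> n4 x y; apply: contra_eq => xy.
have : (1 < #|~: [set x; y]|)%N.
  by have := cardsC [set x; y]; rewrite cards2 xy card_ord; lia.
case/card_gt1P=> a [b []]; rewrite !inE !negb_or => /andP[ax ay] /andP[bx by_] ab.
have exa : complete x a by rewrite /complete /= eq_sym.
have eyb : complete y b by rewrite /complete /= eq_sym.
have [s sxa es] := path_sides_first (pos f x) (pos f a) (brk f x a).
have [s' syb es'] := path_sides_first (pos f y) (pos f b) (brk f y b).
have dis : [disjoint [set x; a] & [set y; b]].
  by rewrite disjoint_pairs xy ay ab [x == b]eq_sym bx.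
have [_ _ []] := gen exa eyb dis sxa syb.
rewrite es es' /abscissa => d _ _ _; rewrite -subr_eq0.
have -> // : det3 v u (pos f x) - det3 v u (pos f y) = det3 v u (pos f x - pos f y).
by rewrite !det3E !coE; ring.
Qed.

(** The difference of the two counts is the algebraic number of crossings of the
two edges in the plane of projection.  By [over_sign_half] and telescoping, only
the positions of the ends of one edge relative to the other edge matter; for
[w] and [z] under the edge [xy], [half_vertex_side] turns below into above. *)
Lemma edge_over_cross x y z w : uniq [:: x; y; z; w] ->
  edge_over f v x y z w - edge_over f v z w x y
  = (before w x y - half_vertex_edge f v u w x y)
    - (before z x y - half_vertex_edge f v u z x y)
    + (half_vertex_edge f v u y z w - half_vertex_edge f v u x z w).
Proof.
case/uniq4=> exy ezw dis.
have sidev c : c \in [set z; w] ->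
   \sum_(s <- edge_sides f x y) half_side v u s (pos f c)
   = before c x y - half_vertex_edge f v u c x y.
  move=> czw; apply/eqP; rewrite eq_sym subr_eq -big_split /=; apply/eqP.
  rewrite /before /abscissa -(path_telescope (fun p => (det3 v u (pos f c) < det3 v u p)%R%:Z) _ _ (brk f x y)).
  apply: eq_big_seq => s sxy.
  (* c is an end of a side of the edge zw, so it avoids the lines through s *)
  have endc (t' : R) (s' : point * point) : on_side s' t' = pos f c -> (t' == 0) || (t' == 1) -> s' \in edge_sides f z w ->
     half_side v u s (pos f c) + half_vertex v u (pos f c) s
     = (det3 v u (pos f c) < det3 v u s.2)%R%:Z - (det3 v u (pos f c) < det3 v u s.1)%R%:Z.
    move=> ec t01 szw; have [mv mu [c1 c2 c3 c4]] := gen exy ezw dis sxy szw.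
    have bd t : 0 <= t <= 1 -> square_boundary t t'.
      move=> ht; rewrite /square_boundary ht.
      by case/orP: t01 => /eqP->; rewrite ?lexx ?ler01 ltxx !andbF.
    apply: half_vertex_side.
    - by case/orP: t01 ec => /eqP->; rewrite ?on_side0 ?on_side1 => <-.
    - by case/orP: t01 ec => /eqP->; rewrite ?on_side0 ?on_side1 => <-.
    - move=> t h /bd/mv m; move/eqP; rewrite subr_eq addrC -ec => /eqP; exact: m.
    - move=> t h /bd/mu m; move/eqP; rewrite subr_eq addrC -ec => /eqP; exact: m.
  case/set2P: czw => ec.
    have [s' szw e'] := path_sides_first (pos f z) (pos f w) (brk f z w).
    by apply/esym/(endc 0 s'); rewrite ?on_side0 ?eqxx ?ec.
  have [s' szw e'] := path_sides_last (pos f z) (pos f w) (brk f z w).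
  by apply/esym/(endc 1 s'); rewrite ?on_side1 ?eqxx ?orbT ?ec.
rewrite -!sidev ?inE ?eqxx ?orbT //.
rewrite [edge_over f v z w x y]exchange_big -sumrB.
transitivity (\sum_(s <- edge_sides f x y)
   ((half_side v u s (pos f w) - half_side v u s (pos f z))
     + \sum_(s' <- edge_sides f z w) (half_vertex v u s.2 s' - half_vertex v u s.1 s'))).
  apply: eq_big_seq => s sxy; rewrite -sumrB.
  rewrite -(path_telescope (half_side v u s) _ _ (brk f z w)) -big_split /=.
  apply: eq_big_seq => s' szw; have [mv mu cor] := gen exy ezw dis sxy szw.
  by apply: over_sign_half => //; apply: disjoint_edge_sides sxy szw.
rewrite big_split sumrB /=; congr (_ + _); rewrite exchange_big -sumrB.
apply: eq_bigr => s' _.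
exact: (path_telescope (fun c => half_vertex v u c s') _ _ (brk f x y)).
Qed.

Definition cycle_lk (s t : seq 'I_n) : int :=
  \sum_(p <- zip s (rot 1 s)) \sum_(q <- zip t (rot 1 t)) edge_over f v p.1 p.2 q.1 q.2.

Lemma sum_cycle_image (s : seq 'I_n) (F : point * point -> int) : uniq s ->
  \sum_(r <- sides (cycle_image f s)) F r
  = \sum_(p <- zip s (rot 1 s)) \sum_(r <- edge_sides f p.1 p.2) F r.
Proof. by move=> us; rewrite sides_cycle_image // big_flatten big_map. Qed.

Lemma zip_rot_edge (s : seq 'I_n) p : uniq s -> (1 < size s)%N ->
  p \in zip s (rot 1 s) -> [/\ p.1 \in s, p.2 \in s & complete p.1 p.2].
Proof.
move=> us s1; rewrite -zip_next // => /mapP[x xs ->] /=; split=> //.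
  by rewrite mem_next.
have [i r er] := rot_to xs; rewrite -(next_rot i us) er.
move: us s1; rewrite -(rot_uniq i) -(size_rot i) er.
by case: r {er} => //= y r; rewrite eqxx inE negb_or => /andP[/andP[]].
Qed.

Section TwoCycles.
Variables s t : seq 'I_n.
Hypotheses (us : uniq s) (ut : uniq t) (s1 : (1 < size s)%N) (t1 : (1 < size t)%N).
Hypothesis st : [disjoint s & t].

Let cycle_sides r r' : r \in sides (cycle_image f s) -> r' \in sides (cycle_image f t) ->
  exists x y z w, [/\ complete x y, complete z w, [disjoint [set x; y] & [set z; w]],
    r \in edge_sides f x y & r' \in edge_sides f z w].
Proof.
rewrite !sides_cycle_image // => /flattenP[_ /mapP[p ps ->] rp] /flattenP[_ /mapP[q qs ->] rq].
have [p1 p2 ep] := zip_rot_edge us s1 ps; have [q1 q2 eq] := zip_rot_edge ut t1 qs.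
exists p.1, p.2, q.1, q.2; split=> //; rewrite disjoint_pairs.
have ne x y : x \in s -> y \in t -> x != y.
  by move=> xs yt; apply: contraTneq yt => <-; rewrite (disjointFr st).
by rewrite !ne.
Qed.

Let generic_cycles : generic_projection v (cycle_image f s) (cycle_image f t).
Proof.
move=> r r' rs rt; have [x [y [z [w [exy ezw d rxy rzw]]]]] := cycle_sides rs rt.
by have [] := gen exy ezw d rxy rzw.
Qed.

Let disjoint_cycles : disjoint_polygons (cycle_image f s) (cycle_image f t).
Proof.
move=> r r' rs rt; have [x [y [z [w [exy ezw d rxy rzw]]]]] := cycle_sides rs rt.
exact: disjoint_edge_sides rxy rzw.
Qed.

Let cycle_lk_total s' t' : uniq s' -> uniq t' ->
  total_over v (cycle_image f s') (cycle_image f t') = cycle_lk s' t'.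
Proof.
move=> us' ut'; rewrite /total_over sum_cycle_image //; apply: eq_bigr => p _.
rewrite exchange_big sum_cycle_image //; apply: eq_bigr => q _.
exact: exchange_big.
Qed.

Lemma linking_number_cycles :
  linking_number (cycle_image f s) (cycle_image f t) = cycle_lk s t.
Proof. by rewrite (linking_numberE v0) // cycle_lk_total. Qed.

(** Needed because [lk] takes the two cycles in an arbitrary order. *)
Lemma cycle_lk_sym : cycle_lk t s = cycle_lk s t.
Proof. by rewrite -!cycle_lk_total // total_over_sym. Qed.
End TwoCycles.

End CompleteGraph.

(** * Sums over injective tuples *)

Section TupleSums.
Variable T : finType.
Implicit Types (A : {set T}) (F : seq T -> int) (x y z : T) (s t : seq T).

Definition tsum k A F : int :=
  \sum_(t : k.-tuple T | all (mem A) t && uniq t) F t.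

Lemma eq_tsum k A F G :
  (forall t, size t = k -> all (mem A) t -> uniq t -> F t = G t) ->
  tsum k A F = tsum k A G.
Proof. by move=> FG; apply: eq_bigr => t /andP[At ut]; rewrite FG ?size_tuple. Qed.

Lemma tsum_cons k A F :
  tsum k.+1 A F = \sum_(x in A) tsum k (A :\ x) (fun t => F (x :: t)).
Proof.
rewrite /tsum pair_big_dep /=.
rewrite (reindex (fun p : T * k.-tuple T => cons_tuple p.1 p.2)) /=; last first.
  exists (fun t : k.+1.-tuple T => (thead t, behead_tuple t)) => [[x t] _ | t _] /=.
    by congr (_, _); apply: val_inj.
  by apply: val_inj => /=; case/tupleP: t.
apply: eq_bigl => -[x t] /=; rewrite -!andbA; congr (_ && _).
have -> : all (mem (A :\ x)) t = (x \notin t) && all (mem A) t.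
  apply/allP/andP=> [h|[xt /allP h] y yt].
    split; first by apply/negP=> /h; rewrite /= !inE eqxx.
    by apply/allP=> y /h; rewrite /= !inE => /andP[].
  by have /= := h y yt; rewrite !inE => ->; rewrite andbT; apply: contraNneq xt => <-.
by rewrite andbCA andbA.
Qed.

Lemma tsum_const k A (c : int) : tsum k A (fun=> c) = (#|A| ^_ k)%:Z * c.
Proof.
rewrite /tsum sumr_const -(card_uniq_tuples k (mem A)) -mulr_natl natz.
by congr (Posz _ * _); apply: eq_card => t; rewrite !inE.
Qed.

Lemma tsumD k A F G : tsum k A (fun t => F t + G t) = tsum k A F + tsum k A G.
Proof. exact: big_split. Qed.

Lemma tsumZ k A c F : tsum k A (fun t => c * F t) = c * tsum k A F.
Proof. by rewrite /tsum mulr_sumr. Qed.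

Lemma tsum_rot k A F i : tsum k A (fun t => F (rot i t)) = tsum k A F.
Proof.
rewrite /tsum [RHS](reindex (fun t : k.-tuple T => [tuple of rot i t])) /=; last first.
  exists (fun t : k.-tuple T => [tuple of rotr i t]) => t _; apply: val_inj => /=;
  by rewrite ?rotK ?rotrK.
by apply: eq_bigl => t; rewrite rot_uniq; congr (_ && _); apply: eq_all_r => x; rewrite mem_rot.
Qed.

Lemma tsum_rev k A F : tsum k A (fun t => F (rev t)) = tsum k A F.
Proof.
rewrite /tsum [RHS](reindex (fun t : k.-tuple T => [tuple of rev t])) /=; last first.
  by exists (fun t : k.-tuple T => [tuple of rev t]) => t _; apply: val_inj => /=; rewrite revK.
by apply: eq_bigl => t; rewrite rev_uniq all_rev.
Qed.

Definition cyc (phi : T -> T -> int) s : int :=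
  \sum_(p <- zip s (rot 1 s)) phi p.1 p.2.

Lemma zip_rot1 s t : size s = size t -> zip (rot 1 s) (rot 1 t) = rot 1 (zip s t).
Proof. by case: s t => [|x s] [|y t] //= [st]; rewrite !rot1_cons zip_rcons. Qed.

Variable phi : T -> T -> int.
Hypothesis phiN : forall x y, phi y x = - phi x y.

Lemma cyc_rot i s : cyc phi (rot i s) = cyc phi s.
Proof.
have rot1 t : cyc phi (rot 1 t) = cyc phi t.
  by rewrite /cyc zip_rot1 ?size_rot //; apply: perm_big; apply: permEl; exact: perm_rot.
elim: i => [|i IH]; first by rewrite rot0.
have [lis|lsi] := ltnP i (size s); last by rewrite rot_oversize // leqW.
by rewrite -add1n rotD // rot1.
Qed.

Lemma head_rot x0 s i : (i < size s)%N -> head x0 (rot i s) = nth x0 s i.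
Proof. by move=> lis; rewrite /rot (drop_nth x0). Qed.

Lemma cyc_heads x0 s :
  cyc phi s = \sum_(i < size s) phi (head x0 (rot i s)) (head x0 (rot 1 (rot i s))).
Proof.
rewrite /cyc (big_nth (x0, x0)) size_zip size_rot minnn big_mkord.
apply: eq_bigr => i _; rewrite nth_zip ?size_rot //= head_rot // rot_rot head_rot ?size_rot //.
Qed.

(** Rotating the tuple moves any factor of the expanded square to the first
arc. *)
Lemma tsum_cyc_sqr k A x0 :
  tsum k A (fun t => cyc phi t ^+ 2)
  = k%:Z * tsum k A (fun t => phi (head x0 t) (head x0 (rot 1 t)) * cyc phi t).
Proof.
pose F t := phi (head x0 t) (head x0 (rot 1 t)) * cyc phi t.
transitivity (tsum k A (fun t => \sum_(i < k) F (rot i t))).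
  apply: eq_tsum => t st _ _; rewrite expr2 {1}(cyc_heads x0) mulr_suml st.
  by apply: eq_bigr => i _; rewrite /F cyc_rot.
rewrite /tsum exchange_big /=.
transitivity (\sum_(i < k) tsum k A F).
  by apply: eq_bigr => i _; exact: (tsum_rot k A F i).
by rewrite sumr_const card_ord -mulr_natl natz.
Qed.

Definition open_sum x s y : int := \sum_(p <- zip (x :: s) (rcons s y)) phi p.1 p.2.

Lemma cyc_cons x s : cyc phi (x :: s) = open_sum x s x.
Proof. by rewrite /cyc rot1_cons. Qed.

Lemma open_sum_cons x z s y : open_sum x (z :: s) y = phi x z + open_sum z s y.
Proof. by rewrite /open_sum /= big_cons. Qed.

Lemma open_sum_rcons x s z y : open_sum x (rcons s z) y = open_sum x s z + phi z y.
Proof.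
rewrite /open_sum -rcons_cons zip_rcons ?size_rcons //= -cats1 big_cat big_seq1 /=.
by [].
Qed.

Lemma open_sum_rev x s y : open_sum y (rev s) x = - open_sum x s y.
Proof.
elim: s x => [|z s IH] x; first by rewrite /open_sum /= !big_seq1 /= phiN.
by rewrite rev_cons open_sum_rcons open_sum_cons IH phiN opprD addrC.
Qed.

Lemma cyc_rev s : cyc phi (rev s) = - cyc phi s.
Proof.
case: s => [|x s]; first by rewrite /cyc big_nil oppr0.
by rewrite rev_cons -rot1_cons cyc_rot !cyc_cons open_sum_rev.
Qed.

(** Averaging over a tuple [q] and its reversal, the arcs inside [q] cancel by
antisymmetry, and only the arcs at the two ends of [q] remain. *)
Lemma tsum_open_sum k A x0 x y :
  tsum k.+1 A (fun q => open_sum y q x)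
  = tsum k.+1 A (fun q => phi y (head x0 q) + phi (head x0 q) x).
Proof.
(* double both sides, and reverse the tuple in one of the two copies *)
have two (a b : int) : a + a = b + b -> a = b by lia.
pose G z := phi y z + phi z x; apply: two.
rewrite -[X in _ + X = _](tsum_rev _ _ (fun q => open_sum y q x)).
rewrite -[X in _ = _ + X](tsum_rev _ _ (fun q => G (head x0 q))).
rewrite -!tsumD; apply: eq_tsum => -[|z q] // _ _ _; case/lastP: q => [|q l].
  by rewrite /G /open_sum /= !big_cons !big_nil /=; ring.
rewrite rev_cons rev_rcons /G !rcons_cons /= !open_sum_cons !open_sum_rcons open_sum_rev.
ring.
Qed.

(** Each injective triple has [(#|A| - 3) ^_ k] injective extensions by [k]
entries. *)
Lemma tsum_heads k A (G : T -> T -> T -> int) (x0 : T) :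
  tsum k.+3 A (fun t => G (nth x0 t 0) (nth x0 t 1) (nth x0 t 2))
  = ((#|A| - 3) ^_ k)%:Z * tsum 3 A (fun t => G (nth x0 t 0) (nth x0 t 1) (nth x0 t 2)).
Proof.
rewrite !tsum_cons mulr_sumr; apply: eq_bigr => x xA.
rewrite !tsum_cons mulr_sumr; apply: eq_bigr => y yA.
rewrite !tsum_cons mulr_sumr; apply: eq_bigr => z zA.
rewrite /= !tsum_const ffactn0 mul1r; congr ((_ ^_ k)%:Z * _).
have := cardsD1 x A; have := cardsD1 y (A :\ x); have := cardsD1 z (A :\ x :\ y).
by rewrite xA yA zA => -> -> ->; lia.
Qed.

Lemma tsum_cyc_sqr_heads k A x0 :
  tsum k.+3 A (fun t => cyc phi t ^+ 2) = (k.+3)%:Z *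
  tsum k.+3 A (fun t => phi (nth x0 t 0) (nth x0 t 1) * (phi (nth x0 t 0) (nth x0 t 1)
    + (phi (nth x0 t 1) (nth x0 t 2) + phi (nth x0 t 2) (nth x0 t 0)))).
Proof.
rewrite (tsum_cyc_sqr _ _ x0); congr (_ * _).
rewrite !tsum_cons; apply: eq_bigr => x xA.
rewrite !tsum_cons; apply: eq_bigr => y yA.
rewrite /= !tsumZ; congr (_ * _).
rewrite [RHS]tsumD.
transitivity (tsum k.+1 (A :\ x :\ y) (fun t => phi x y + open_sum y t x)).
  by apply: eq_tsum => t _ _ _; rewrite cyc_cons open_sum_cons.
rewrite tsumD; congr (_ + _); rewrite (tsum_open_sum _ _ x0).
by apply: eq_tsum => t _ _ _; case: t.
Qed.

(** For all tuple lengths, the sum reduces to the same sum over triples by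
[tsum_cyc_sqr_heads]; comparison with length 3 eliminates it. *)
Theorem tsum_cyc_triangles k A :
  3 * tsum k.+3 A (fun t => cyc phi t ^+ 2)
  = (k.+3)%:Z * ((#|A| - 3) ^_ k)%:Z * tsum 3 A (fun t => cyc phi t ^+ 2).
Proof.
case: (set_0Vmem A) => [->|[x0 _]].
  by rewrite /tsum !big_pred0 ?mulr0 // => t; case/tupleP: t => x t; rewrite /= inE.
rewrite !(tsum_cyc_sqr_heads _ _ x0).
rewrite (@tsum_heads k A (fun a b c => phi a b * (phi a b + (phi b c + phi c a)))); ring.
Qed.
End TupleSums.

(** * The closed walks around a cycle *)

Section CyclicSequences.
Variable T : finType.
Implicit Types (x y z : T) (s t : seq T).

Lemma next_neq_prev s x : uniq s -> (2 < size s)%N -> x \in s -> next s x != prev s x.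
Proof.
move=> us s2 xs; have [i r er] := rot_to xs.
rewrite -(next_rot i us) -(prev_rot i us) er.
move: us s2; rewrite -(rot_uniq i) -(size_rot i) er.
case: r {er} => [|y [|z r]] // /and3P[xn yn _] _.
rewrite prev_nth mem_head [next _ _]/= eqxx.
have -> : index x [:: y, z & r] = size [:: y, z & r].
  by apply/eqP; rewrite eqn_leq index_size leqNgt index_mem.
rewrite -[size _]/(size [:: x, y, z & r]).-1 nth_last /=; apply: contraNneq yn => ->; exact: mem_last.
Qed.

Lemma next_neq s x : uniq s -> (1 < size s)%N -> x \in s -> next s x != x.
Proof.
move=> us s1 xs; have [i r er] := rot_to xs; rewrite -(next_rot i us) er.
move: us s1; rewrite -(rot_uniq i) -(size_rot i) er.
by case: r {er} => //= y r; rewrite eqxx eq_sym inE negb_or => /andP[/andP[]].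
Qed.

Lemma uniq_traject s x : uniq (x :: s) ->
  x :: s = traject (next (x :: s)) x (size (x :: s)).
Proof.
move=> us; have := cycle_next us; rewrite /= rcons_path => /andP[/fpathP[m em] _].
by rewrite {1}em em size_traject.
Qed.

Lemma mem_cycle_edges s x y : uniq s -> x \in s -> x != y ->
  ([set x; y] \in cycle_edges s) = (y == next s x) || (y == prev s x).
Proof.
move=> us xs xy; apply/imsetP/orP => [[z zs e]|[/eqP->|/eqP->]].
- have : x \in [set z; next s z] by rewrite -e !inE eqxx.
  have : y \in [set z; next s z] by rewrite -e !inE eqxx orbT.
  case/set2P=> ey /set2P[] ex; rewrite ex ey ?eqxx in xy *; rewrite ?eqxx; auto.
  by right; rewrite prev_next.
- by exists x.
- by exists (prev s x); rewrite ?mem_prev // next_prev // setUC.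
Qed.

Lemma cover_cycle_edges s : cover (cycle_edges s) = [set x in s].
Proof.
apply/setP=> x; rewrite inE; apply/bigcupP/idP => [[E /imsetP[z zs ->]]|xs].
  by case/set2P=> ->; rewrite ?mem_next.
exists [set x; next s x]; last by rewrite !inE eqxx.
exact: imset_f.
Qed.

Lemma card_cycle_edges s : uniq s -> (2 < size s)%N -> #|cycle_edges s| = size s.
Proof.
move=> us s2; rewrite card_in_imset ?(card_uniqP us) // => x y xs ys /= e.
have : x \in [set y; next s y] by rewrite -e !inE eqxx.
case/set2P=> // ex.
have : next s x \in [set y; next s y] by rewrite -e !inE eqxx orbT.
case/set2P=> ex'.
  have py : prev s x = y by rewrite ex prev_next.
  by have := next_neq_prev us s2 xs; rewrite ex' py eqxx.
by have := next_neq us (ltnW s2) xs; rewrite ex' -ex eqxx.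
Qed.

Lemma rot_rev_cycle_edges s i : uniq s ->
  cycle_edges (rot i s) = cycle_edges s /\ cycle_edges (rot i (rev s)) = cycle_edges s.
Proof.
have r t : uniq t -> cycle_edges (rot i t) = cycle_edges t.
  move=> ut; rewrite /cycle_edges; apply/setP=> E.
  by apply/imsetP/imsetP => -[x]; rewrite ?mem_rot => xt ->; exists x; rewrite ?mem_rot ?next_rot.
move=> us; split; first exact: r.
rewrite r ?rev_uniq //; apply/setP=> E; apply/imsetP/imsetP => -[x].
  rewrite mem_rev => xs ->; exists (prev s x); rewrite ?mem_prev //.
  by rewrite next_rev // next_prev // setUC.
move=> xs ->; exists (next s x); rewrite ?mem_rev ?mem_next //.
by rewrite next_rev // prev_next // setUC.
Qed.

Lemma eq_traject (f g : T -> T) x k :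
  (forall j, f (iter j f x) = g (iter j f x)) -> traject f x k = traject g x k.
Proof.
elim: k x => //= k IH x fg; have /= e := fg 0; rewrite -e; congr (_ :: _).
by apply: IH => j; rewrite -iterSr fg.
Qed.

(** The successor of a vertex in [t] is one of its two neighbours in the cycle,
and it cannot be the one from which the walk has just come. *)
Lemma follow_next s t x : uniq s -> uniq t -> (2 < size s)%N -> s =i t ->
  cycle_edges s = cycle_edges t -> x \in s -> next s x = next t x ->
  forall j, next s (iter j (next s) x) = next t (iter j (next s) x).
Proof.
move=> us ut s2 st e xs ex; elim=> [|j IH] //.
rewrite [iter _.+1 _ _]iterS; set y := iter j _ x in IH *.
have ys : y \in s by rewrite /y; elim: (j) => // i; rewrite iterS mem_next.
have ns : next s y \in s by rewrite mem_next.
have nn : next s y != next s (next s y) by rewrite eq_sym next_neq ?(ltnW s2).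
have := mem_cycle_edges us ns nn; rewrite eqxx e mem_cycle_edges // -?st //.
case/orP=> [/eqP //|/eqP].
rewrite {2}IH prev_next // => e1.
by have := next_neq_prev us s2 ns; rewrite e1 prev_next // eqxx.
Qed.

(** A closed walk around a cycle is determined by its start and its direction. *)
Lemma eq_cycle_edges s t : uniq s -> uniq t -> (2 < size s)%N ->
  cycle_edges s = cycle_edges t ->
  exists2 i, (i < size t)%N & s = rot i t \/ s = rot i (rev t).
Proof.
move=> us ut s2 e.
have st : s =i t.
  by move=> x; have := cover_cycle_edges s; rewrite e cover_cycle_edges => /setP/(_ x); rewrite !inE.
have sz : size s = size t by apply/eqP; rewrite -uniq_size_uniq.
have [x0 [s' es]] : exists x0 s', s = x0 :: s' by case: (s) s2 => // x0 s' _; exists x0, s'.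
have x0s : x0 \in s by rewrite es mem_head.
have rotE r : uniq r -> s =i r -> cycle_edges s = cycle_edges r -> next s x0 = next r x0 ->
    s = rot (index x0 r) r.
  move=> ur sr er e0; have x0r : x0 \in r by rewrite -sr.
  have szr : size s = size r by apply/eqP; rewrite -uniq_size_uniq.
  have hd : exists r', rot (index x0 r) r = x0 :: r' by rewrite rot_index //; eexists.
  have [r' er'] := hd.
  have ts := @uniq_traject s' x0; rewrite -es in ts; rewrite {1}ts //.
  have tr := @uniq_traject r' x0; rewrite -er' rot_uniq size_rot in tr; rewrite tr //.
  rewrite szr (@eq_traject _ (next r)); last exact: follow_next.
  by apply/esym/eq_traject => j; rewrite next_rot.
have t2 : (2 < size t)%N by rewrite -sz.
have x0t : x0 \in t by rewrite -st.
have nn : x0 != next s x0 by rewrite eq_sym next_neq // ltnW.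
have := mem_cycle_edges us x0s nn; rewrite eqxx e mem_cycle_edges //.
case/orP=> /eqP e0.
  by exists (index x0 t); rewrite ?index_mem //; left; apply: rotE.
exists (index x0 (rev t)); first by rewrite -(size_rev t) index_mem mem_rev.
right; apply: rotE; rewrite ?rev_uniq //.
- by move=> x; rewrite mem_rev.
- by have [_] := rot_rev_cycle_edges 0 ut; rewrite rot0 => ->.
- by rewrite next_rev.
Qed.

(** There are [k] starting points and two directions, and the walks are distinct
since the two neighbours of a vertex differ for [k] at least 3. *)
Lemma card_traversals k s : uniq s -> size s = k -> (2 < k)%N ->
  #|[set t : k.-tuple T | uniq t && (cycle_edges t == cycle_edges s)]| = (2 * k)%N.
Proof.
move=> us sk k2.
(* all closed walks, in the one direction and in the other *)
pose L := [seq rot i s | i <- iota 0 k] ++ [seq rot i (rev s) | i <- iota 0 k].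
have [x0 [s' es]] : exists x0 s', s = x0 :: s' by case: (s) sk k2 => [<-|x0 s'] //; exists x0, s'.
have uL : uniq L.
  have inj (r : seq T) : uniq r -> size r = k -> {in iota 0 k &, injective (fun i => rot i r)}.
    move=> ur rk i j; rewrite !mem_iota !add0n /= -rk => li lj e.
    have := congr1 (head x0) e; rewrite !head_rot // => /eqP.
    by rewrite nth_uniq // => /eqP.
  rewrite cat_uniq !map_inj_in_uniq ?iota_uniq ?andbT /=; first last.
  - exact: inj.
  - by apply: inj; rewrite ?rev_uniq ?size_rev.
  apply/hasPn=> _ /mapP[i _ ->]; apply/negP=> /mapP[j _ e].
  have x0s : x0 \in s by rewrite es mem_head.
  have := congr1 (fun r => next r x0) e; rewrite !next_rot ?rev_uniq // next_rev // => ep.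
  by have := next_neq_prev us _ x0s; rewrite sk k2 -ep eqxx => /(_ isT).
have sL : size L = (2 * k)%N by rewrite size_cat !size_map size_iota mul2n addnn.
rewrite cardE -(size_map val) -sL; apply: perm_size; apply: uniq_perm => //.
  by rewrite map_inj_uniq ?enum_uniq //; exact: val_inj.
move=> r; apply/mapP/idP => [[t]|].
  rewrite mem_enum inE => /andP[ut /eqP et] -> /=.
  have t2 : (2 < size t)%N by rewrite size_tuple.
  have [i li [->|->]] := eq_cycle_edges ut us t2 et.
    by rewrite mem_cat; apply/orP; left; apply: map_f; rewrite mem_iota /= -sk.
  by rewrite mem_cat; apply/orP; right; apply: map_f; rewrite mem_iota /= -sk.
have mk (q : seq T) : uniq q -> size q = k -> cycle_edges q = cycle_edges s ->
    exists2 t : k.-tuple T, t \in enum [set t : k.-tuple T | uniq t && (cycle_edges t == cycle_edges s)] & q = val t.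
  move=> uq qk eq; have qk' : size q == k by apply/eqP.
  by exists (Tuple qk'); rewrite // mem_enum inE /= uq eq eqxx.
rewrite mem_cat => /orP[] /mapP[i _ ->]; apply: mk;
  rewrite ?rot_uniq ?rev_uniq ?size_rot ?size_rev //;
  by have [] := rot_rev_cycle_edges i us.
Qed.

End CyclicSequences.

(** * From pairs of cycles to pairs of tuples *)

Section Gamma.
Variable n : nat.
Notation T := 'I_n.
Notation K := (@complete n).
Implicit Types (s t : seq T) (C D : {set {set T}}).

Lemma complete_ucycle s : (1 < size s)%N -> ucycleb K s = uniq s.
Proof.
move=> s1; rewrite /ucycleb; case us: (uniq s); last by rewrite andbF.
rewrite andbT; apply: cycle_from_next => // x xs.
by rewrite /complete /= eq_sym next_neq.
Qed.

Lemma is_cycleP p C : reflect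
  ((3 <= p)%N /\ exists s : p.-tuple T, uniq s /\ C = cycle_edges s)
  (is_cycle K p C).
Proof.
rewrite /is_cycle; case: leqP => p3 /=; first by constructor=> -[].
apply: (iffP existsP) => [[s]|[_ [s [us ->]]]].
  rewrite /traverses complete_ucycle ?size_tuple ?(ltn_trans _ p3) //.
  by case/andP=> us /eqP ->; split=> //; exists s.
by exists s; rewrite /traverses complete_ucycle ?size_tuple ?(ltn_trans _ p3) // us eqxx.
Qed.

Lemma card_is_cycle p C : is_cycle K p C -> #|C| = p.
Proof. by case/is_cycleP=> p3 [s [us ->]]; rewrite card_cycle_edges ?size_tuple. Qed.

(** Ordered pairs, while the elements of Gamma are unordered. *)
Definition cycle_pairs p q : {set {set {set T}} * {set {set T}}} :=
  [set c | [&& is_cycle K p c.1, is_cycle K q c.2 & [disjoint cover c.1 & cover c.2]]].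

Lemma GammaE p q : Gamma K p q = [set [set c.1; c.2] | c in cycle_pairs p q].
Proof.
apply/setP=> l; apply/imset2P/imsetP => [[C D Cc]|[[C D]]].
  rewrite inE => /andP[Dc dis] ->; by exists (C, D) => //; rewrite inE; apply/and3P; split.
rewrite inE => /and3P[/= Cc Dc dis] ->; exists C D => //.
by rewrite inE; apply/andP; split.
Qed.

Lemma cycle_pairs_neq p q C D : (C, D) \in cycle_pairs p q -> C != D.
Proof.
rewrite inE => /and3P[/= /is_cycleP[p3 [s [us ->]]] _ dis].
apply: contraTneq dis => <-; rewrite -setI_eq0 setIid cover_cycle_edges.
case: (tval s) (size_tuple s) => [e|x r _]; first by rewrite -e in p3.
by apply/set0Pn; exists x; rewrite inE mem_head.
Qed.

Lemma cycle_pairs_swap p C D : (C, D) \in cycle_pairs p p -> (D, C) \in cycle_pairs p p.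
Proof. by rewrite !inE disjoint_sym => /and3P[-> -> ->]. Qed.

Lemma eq_set2 (U : finType) (a b c d : U) : a != b ->
  ([set c; d] == [set a; b]) = ((c, d) == (a, b)) || ((c, d) == (b, a)).
Proof.
move=> ab; apply/eqP/orP => [e|[/eqP[-> ->]|/eqP[-> ->]]] //; last exact: setUC.
have : a \in [set c; d] by rewrite e !inE eqxx.
have : b \in [set c; d] by rewrite e !inE eqxx orbT.
by case/set2P=> eb /set2P[] ea; rewrite ?ea ?eb ?eqxx in ab *; auto.
Qed.

(** If [p = q], each element of Gamma comes from two ordered pairs. *)
Lemma sum_Gamma p q (F : {set {set {set T}}} -> int) :
  \sum_(c in cycle_pairs p q) F [set c.1; c.2]
  = (if p == q then 2 else 1) * \sum_(l in Gamma K p q) F l.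
Proof.
rewrite GammaE (partition_big_imset (fun c => [set c.1; c.2])) /= mulr_sumr.
apply: eq_bigr => _ /imsetP[[C D] cCD ->] /=.
have ne := cycle_pairs_neq cCD.
under eq_bigr => c /andP[_ /eqP ->] do [].
have -> : (if p == q then 2 else 1) = (if p == q then 2 else 1)%N :> int by case: ifP.
rewrite sumr_const -mulr_natl natz; congr (Posz _ * _).
case: eqP cCD => [<-|pq] cCD.
  rewrite -(_ : #|[set (C, D); (D, C)]| = 2%N); last first.
    by rewrite cards2 xpair_eqE negb_and ne.
  apply: eq_card => -[X Y]; rewrite [LHS]unfold_in /= eq_set2 // in_set2.
  apply: andb_idl => /orP[] /eqP[-> ->]; last exact: cycle_pairs_swap.
  exact: cCD.
rewrite -(cards1 (C, D)); apply: eq_card => -[X Y]; rewrite [LHS]unfold_in /= eq_set2 // in_set1.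
apply/andP/idP => [[XY /orP[//|/eqP[eX eY]]]|/eqP[-> ->]]; last by rewrite cCD eqxx.
move: XY cCD; rewrite eX eY !inE /= => /and3P[/card_is_cycle Dp _ _] /and3P[_ /card_is_cycle Dq _].
by case: pq; rewrite -Dp.
Qed.

Variables (F : {set {set {set T}}} -> int) (H : seq T -> seq T -> int).
Hypothesis FH : forall s t, uniq s -> uniq t -> (2 < size s)%N -> (2 < size t)%N ->
  [disjoint s & t] -> F [set cycle_edges s; cycle_edges t] = H s t.

Lemma tsum_cycle_pairs p q : (2 < p)%N -> (2 < q)%N ->
  tsum p setT (fun s => tsum q (~: [set x in s]) (H s))
  = (2 * p)%:Z * (2 * q)%:Z * \sum_(c in cycle_pairs p q) F [set c.1; c.2].
Proof.
move=> p2 q2; rewrite /tsum pair_big_dep /=.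
rewrite (partition_big (fun st : p.-tuple T * q.-tuple T => (cycle_edges st.1, cycle_edges st.2))
   (mem (cycle_pairs p q))) /=; last first.
  move=> [s t] /= /andP[/andP[_ us] /andP[ts ut]]; rewrite inE /=.
  apply/and3P; split; first by apply/is_cycleP; split=> //; exists s.
    by apply/is_cycleP; split=> //; exists t.
  rewrite /= !cover_cycle_edges -setI_eq0; apply/eqP/setP=> x; rewrite !inE.
  apply/negP=> /andP[xs /(allP ts)]; by rewrite /= !inE xs.
rewrite mulr_sumr; apply: eq_bigr => -[C D].
rewrite inE => /and3P[/= Cp Dq dis].
have [_ [s0 [us0 Cs0]]] := is_cycleP _ _ Cp.
have [_ [t0 [ut0 Dt0]]] := is_cycleP _ _ Dq.
transitivity (\sum_(st in setX [set s : p.-tuple T | uniq s && (cycle_edges s == cycle_edges s0)]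
    [set t : q.-tuple T | uniq t && (cycle_edges t == cycle_edges t0)]) F [set C; D]); last first.
  by rewrite sumr_const cardsX !card_traversals ?size_tuple // -mulr_natl natz PoszM.
have disE (s : p.-tuple T) (t : q.-tuple T) : cycle_edges s = C -> cycle_edges t = D -> [disjoint s & t].
  move=> sC tD; move: dis; rewrite -sC -tD !cover_cycle_edges -!setI_eq0 => /eqP/setP d.
  rewrite disjoint_subset; apply/subsetP=> x xs; rewrite inE; apply/negP=> xt.
  by have := d x; rewrite !inE xs xt.
apply: eq_big => [[s t]|[s t]] /=.
  rewrite xpair_eqE !inE -Cs0 -Dt0; apply/idP/idP.
    by case/andP=> /andP[/andP[_ ->] /andP[_ ->]] /andP[-> ->].
  case/andP=> /andP[us /eqP sC] /andP[ut /eqP tD]; rewrite us ut sC tD !eqxx !andbT.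
  apply/andP; split; first by apply/allP=> x _; rewrite /= inE.
  by apply/allP=> x xt; rewrite /= !inE; apply: contraTN xt => xs; rewrite (disjointFr (disE _ _ sC tD)).
case/andP=> /andP[/andP[_ us] /andP[_ ut]] /eqP[sC tD].
by rewrite -sC -tD FH ?size_tuple // disE.
Qed.

Lemma tsum_Gamma p q : (2 < p)%N -> (2 < q)%N ->
  tsum p setT (fun s => tsum q (~: [set x in s]) (H s))
  = (2 * p)%:Z * (2 * q)%:Z * ((if p == q then 2 else 1) * \sum_(l in Gamma K p q) F l).
Proof. by move=> p2 q2; rewrite tsum_cycle_pairs // sum_Gamma. Qed.
End Gamma.

(** * Reduction to pairs of triangles *)

Lemma tsum_swap (T : finType) p q (G : seq T -> seq T -> int) :
  tsum p setT (fun s => tsum q (~: [set x in s]) (G s))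
  = tsum q setT (fun t => tsum p (~: [set x in t]) (fun s => G s t)).
Proof.
have dis (s t : seq T) : all (mem (~: [set x in s])) t = all (mem (~: [set x in t])) s.
  by apply/allP/allP=> h x xs; rewrite /= !inE; apply: contraL xs => /h; rewrite /= !inE.
have inT (s : seq T) : all (mem [set: T]) s by apply/allP=> x _; rewrite /= inE.
rewrite /tsum (exchange_big_dep (fun t : q.-tuple T => all (mem setT) t && uniq t)) /=.
  by apply: eq_bigr => t /andP[_ ut]; apply: eq_bigl => s; rewrite inT ut dis andbT andbC.
by move=> s t _ /andP[_ ut]; rewrite inT.
Qed.

Section CycleSums.
Variables (T : finType) (om : T -> T -> T -> T -> int).
Hypothesis omN : forall x y z w, om y x z w = - om x y z w.
Hypothesis omNr : forall x y z w, om x y w z = - om x y z w.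

Definition cyc2 (s t : seq T) : int := cyc (fun x y => cyc (om x y) t) s.

Lemma cyc2E s t : cyc2 s t = cyc (fun z w => cyc (fun x y => om x y z w) s) t.
Proof. exact: exchange_big. Qed.

Lemma cycN (phi : T -> T -> int) s : cyc (fun x y => - phi x y) s = - cyc phi s.
Proof. by rewrite /cyc sumrN. Qed.

Lemma cyc_ext (phi psi : T -> T -> int) s : (forall x y, phi x y = psi x y) -> cyc phi s = cyc psi s.
Proof. by move=> e; apply: eq_bigr => p _. Qed.

Lemma omNl_cyc t x y : cyc (om y x) t = - cyc (om x y) t.
Proof. by rewrite -cycN; apply: cyc_ext => z w. Qed.

Lemma omNr_cyc s z w : cyc (fun x y => om x y w z) s = - cyc (fun x y => om x y z w) s.
Proof. by rewrite -cycN; apply: cyc_ext => x y. Qed.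

(** The sum of squares over all pairs of disjoint injective tuples, each cycle
being counted once for every closed walk around it. *)
Definition pair_sum p q : int :=
  tsum p setT (fun s => tsum q (~: [set x in s]) (fun t => cyc2 s t ^+ 2)).

Lemma card_uniq_setC (s : seq T) : uniq s -> #|~: [set x in s]| = (#|T| - size s)%N.
Proof.
move=> us; have := cardsC [set x in s].
by rewrite (eq_card (in_set (mem s))) (card_uniqP us) => <-; rewrite addKn.
Qed.

(** First replace the second tuple by a triple, in the complement of the first
one, which has exactly [q] elements; then the first tuple by a triple, in the
complement of that triple. *)
Lemma pair_sum_triangles p q : (2 < p)%N -> (2 < q)%N -> #|T| = (p + q)%N ->
  9 * pair_sum p q = (p * q * (#|T| - 6)`!)%N%:Z * pair_sum 3 3.
Proof.
move=> p2 q2 Tpq.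
have stepq : 3 * pair_sum p q = (q * (q - 3)`!)%N%:Z * pair_sum p 3.
  rewrite /pair_sum -!tsumZ; apply: eq_tsum => s sp _ us.
  have := tsum_cyc_triangles (omNr_cyc s) (q - 3) (~: [set x in s]).
  rewrite card_uniq_setC // sp Tpq addKn ffactnn -PoszM.
  have -> : (q - 3).+3 = q by lia.
  have e k : tsum k (~: [set x in s]) (fun t => cyc2 s t ^+ 2)
     = tsum k (~: [set x in s]) (fun t => cyc (fun z w => cyc (fun x y => om x y z w) s) t ^+ 2).
    by apply: eq_tsum => t _ _ _; rewrite cyc2E.
  by rewrite -!e.
have stepp : 3 * pair_sum p 3 = (p * ((#|T| - 6) ^_ (p - 3)))%N%:Z * pair_sum 3 3.
  rewrite /pair_sum tsum_swap [X in _ = _ * X]tsum_swap -!tsumZ; apply: eq_tsum => t sp _ ut.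
  have := tsum_cyc_triangles (omNl_cyc t) (p - 3) (~: [set x in t]).
  rewrite card_uniq_setC // sp -subnDA -PoszM.
  by have -> : (p - 3).+3 = p by lia.
have -> : 9 * pair_sum p q = 3 * (3 * pair_sum p q) by ring.
rewrite stepq mulrCA stepp mulrA -PoszM; congr (Posz _ * _).
have := @ffact_fact (#|T| - 6) (p - 3); have -> : (#|T| - 6 - (p - 3) = q - 3)%N by lia.
by move=> <-; [ring | lia].
Qed.
End CycleSums.

Section EmbeddingSums.
Variables (R : realType) (n : nat) (f : spatial_embedding R (@complete n)).
Notation point := 'rV[R]_3.
Notation T := 'I_n.
Notation K := (@complete n).
Variables (v u : point).
Hypothesis v0 : v != 0.
Hypothesis gen : generic_for_edges f v u.

(** Setting the value to 0 at degenerate edges makes the function antisymmetric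
without exception. *)
Definition edge_lk (x y z w : T) : int :=
  if (x != y) && (z != w) then edge_over f v x y z w else 0.

Lemma edge_lkN x y z w : edge_lk y x z w = - edge_lk x y z w.
Proof.
rewrite /edge_lk eq_sym; case: eqP => [|/eqP xy] /=; first by rewrite oppr0.
by case: eqP => _ /=; rewrite ?oppr0 // edge_over_swap.
Qed.

Lemma edge_lkNr x y z w : edge_lk x y w z = - edge_lk x y z w.
Proof.
rewrite /edge_lk [w == z]eq_sym; case: (x == y) => /=; first by rewrite oppr0.
by case: eqP => [|/eqP zw] /=; rewrite ?oppr0 // edge_over_swapr.
Qed.

Lemma cycle_lkE (s t : seq T) : uniq s -> uniq t -> (1 < size s)%N -> (1 < size t)%N ->
  cycle_lk f v s t = cyc2 edge_lk s t.
Proof.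
move=> us ut s1 t1; apply: eq_big_seq => p /(zip_rot_edge us s1)[_ _ ep].
by apply: eq_big_seq => q /(zip_rot_edge ut t1)[_ _ eq]; rewrite /edge_lk (ep : p.1 != p.2) (eq : q.1 != q.2).
Qed.

Lemma cyc2_sqr_edges s s' t t' : uniq s -> uniq s' -> (2 < size s)%N ->
  cycle_edges s = cycle_edges s' -> uniq t -> uniq t' -> (2 < size t)%N ->
  cycle_edges t = cycle_edges t' -> cyc2 edge_lk s t ^+ 2 = cyc2 edge_lk s' t' ^+ 2.
Proof.
move=> us us' s2 es ut ut' t2 et.
transitivity (cyc2 edge_lk s' t ^+ 2).
  have [i _ [->|->]] := eq_cycle_edges us us' s2 es; rewrite /cyc2 !(cyc_rot, cyc_rev) ?sqrrN //;
  exact: (omNl_cyc edge_lkN).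
have [i _ [->|->]] := eq_cycle_edges ut ut' t2 et; rewrite !cyc2E !(cyc_rot, cyc_rev) ?sqrrN //;
  exact: (omNr_cyc edge_lkNr).
Qed.

Lemma orientationP p C : is_cycle K p C ->
  [/\ uniq (orientation K C), size (orientation K C) = p & cycle_edges (orientation K C) = C].
Proof.
move=> Cp; have [p3 [s [us eC]]] := is_cycleP _ _ Cp.
rewrite /orientation (card_is_cycle Cp); case: pickP => [t /andP[ut /eqP et]|/(_ s)].
  by split; rewrite ?size_tuple // -1?et //; case/andP: ut.
by rewrite /traverses complete_ucycle ?size_tuple ?(ltn_trans _ p3) // us eC eqxx.
Qed.

Lemma enum_set2 (U : finType) (a b : U) : a != b ->
  enum [set a; b] = [:: a; b] \/ enum [set a; b] = [:: b; a].
Proof.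
move=> ab; have : perm_eq (enum [set a; b]) [:: a; b].
  apply: uniq_perm; rewrite ?enum_uniq //= ?inE ?ab // => x.
  by rewrite mem_enum !inE.
move=> pe; have := perm_size pe; case: (enum _) pe => [|c [|d []]] // pe _.
have : c \in [:: a; b] by rewrite -(perm_mem pe) mem_head.
rewrite !inE => /orP[]/eqP ec; move: pe; rewrite ec.
  by rewrite perm_cons => /perm_small_eq -> //; left.
rewrite -[X in perm_eq _ X](revK [:: a; b]) perm_sym perm_rev perm_sym perm_cons.
by move=> /perm_small_eq -> //; right.
Qed.

(** The orientations and the order of the components chosen in [lk] affect only
the sign. *)
Lemma lk_sqr s t : uniq s -> uniq t -> (2 < size s)%N -> (2 < size t)%N ->
  [disjoint s & t] ->
  lk f [set cycle_edges s; cycle_edges t] ^+ 2 = cyc2 edge_lk s t ^+ 2.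
Proof.
move=> us ut s2 t2 st.
have cs : is_cycle K (size s) (cycle_edges s).
  by apply/is_cycleP; split=> //; exists (in_tuple s).
have ct : is_cycle K (size t) (cycle_edges t).
  by apply/is_cycleP; split=> //; exists (in_tuple t).
have dis : [disjoint cover (cycle_edges s) & cover (cycle_edges t)].
  rewrite !cover_cycle_edges -setI_eq0; apply/eqP/setP=> x; rewrite !inE.
  by apply/negP=> /andP[xs]; rewrite (disjointFr st).
have ne : cycle_edges s != cycle_edges t.
  by apply: (@cycle_pairs_neq n (size s) (size t)); rewrite inE /= cs ct dis.
have [uo so eo] := orientationP cs; have [uo' so' eo'] := orientationP ct.
set o := orientation K _ in uo so eo; set o' := orientation K _ in uo' so' eo'.
have os : o =i s.
  by move=> x; have /setP/(_ x) := cover_cycle_edges o; rewrite eo cover_cycle_edges !inE.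
have ot : o' =i t.
  by move=> x; have /setP/(_ x) := cover_cycle_edges o'; rewrite eo' cover_cycle_edges !inE.
have oo' : [disjoint o & o'] by rewrite (eq_disjoint os) (eq_disjoint_r ot).
have o1 : (1 < size o)%N by rewrite so ltnW.
have o'1 : (1 < size o')%N by rewrite so' ltnW.
have main : cycle_lk f v o o' ^+ 2 = cyc2 edge_lk s t ^+ 2.
  by rewrite cycle_lkE //; apply: cyc2_sqr_edges; rewrite ?so ?so'.
rewrite /lk; have [->|->] := enum_set2 ne; rewrite -/o -/o'.
  by rewrite (linking_number_cycles v0 gen).
rewrite (linking_number_cycles v0 gen) 1?disjoint_sym //.
by rewrite (cycle_lk_sym v0 gen).
Qed.

(** A pair of cycles corresponds to [2 * p * (2 * q)] pairs of tuples, hence the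
identity [pair_sum_triangles] can be divided by [36 * p * q]. *)
Theorem sum_Gamma_lk_sqr p q : (2 < p)%N -> (2 < q)%N -> n = (p + q)%N ->
  (if p == q then 2 else 1) * \sum_(l in Gamma K p q) lk f l ^+ 2
  = 2 * (n - 6)`!%N%:Z * \sum_(l in Gamma K 3 3) lk f l ^+ 2.
Proof.
move=> p2 q2 npq.
have H := @tsum_Gamma n (fun l => lk f l ^+ 2) _ lk_sqr.
have := @pair_sum_triangles _ edge_lk edge_lkN edge_lkNr p q p2 q2; rewrite card_ord => /(_ npq).
rewrite /pair_sum !H //.
set A := \sum_(l in Gamma K p q) _; set B := \sum_(l in Gamma K 3 3) _.
rewrite eqxx => e.
have pq0 : (p * q)%N%:Z != 0 by rewrite eqz_nat -lt0n muln_gt0 !(ltn_trans _ p2, ltn_trans _ q2).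
apply: (mulfI pq0); apply: (mulfI (isT : (36 : int) != 0)).
move: e; rewrite !PoszM; set k := (if _ then _ else _) => e.
by apply: etrans (etrans _ e) _; ring.
Qed.
End EmbeddingSums.

(** * Parity for six vertices *)

Definition par (x : int) : bool := odd `|x|%N.

Lemma parD x y : par (x + y) = par x (+) par y.
Proof. rewrite /par; lia. Qed.

Lemma parN x : par (- x) = par x.
Proof. by rewrite /par abszN. Qed.

Lemma par_sqr x : par (x ^+ 2) = par x.
Proof. by rewrite /par abszX oddX. Qed.

Lemma par_sum (I : Type) (r : seq I) (P : pred I) (F : I -> int) :
  par (\sum_(i <- r | P i) F i) = \big[addb/false]_(i <- r | P i) par (F i).
Proof. exact: (big_morph par parD). Qed.

Definition even_counts (I : eqType) (r : seq I) : bool :=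
  all (fun i => ~~ odd (count_mem i r)) r.

(** Sums modulo 2 are compared by counting the occurrences of each index, so
that identities between explicit sums can be decided by computation. *)
Lemma xor_even (I : eqType) (r : seq I) (F : I -> bool) :
  even_counts r -> \big[addb/false]_(i <- r) F i = false.
Proof.
move=> /allP ev; rewrite -big_undup_iterop_count big1_seq // => i /andP[_].
rewrite mem_undup => /ev; move: (count_mem i r) (F i) => k b.
have -> : iterop k addb b false = odd k && b.
  case: k => // k; rewrite iteropS; elim: k => [|k IH]; first by case: b.
  by rewrite iterS IH /=; case: (odd k) b {IH} => [] [].
by move/negbTE->.
Qed.

Lemma xor_eq (I : eqType) (r r' : seq I) (F : I -> bool) :
  even_counts (r ++ r') -> \big[addb/false]_(i <- r) F i = \big[addb/false]_(i <- r') F i.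
Proof.
move/(xor_even F); rewrite big_cat /=.
by case: (\big[_/_]_(i <- r) _) (\big[_/_]_(i <- r') _) => [] [].
Qed.

(** The ten ways to split six vertices into two triangles; the first triangle
contains the vertex 0. *)
Definition splits : seq (seq nat) :=
  [seq s <- permutations (iota 0 6) |
    [&& nth 0 s 0 == 0, nth 0 s 1 < nth 0 s 2 & sorted ltn (drop 3 s)]]%N.

Section CompleteGraphSix.
Variables (T : finType) (om : T -> T -> T -> T -> int) (g : T -> T -> T -> int).
Variables (R : realDomainType) (h : T -> R).
Hypothesis omN : forall x y z w, om y x z w = - om x y z w.
Hypothesis omNr : forall x y z w, om x y w z = - om x y z w.
Let bef c x y : int := (h c < h y)%R%:Z - (h c < h x)%R%:Z.
Hypothesis omX : forall x y z w, uniq [:: x; y; z; w] ->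
  om x y z w - om z w x y = (bef w x y - g w x y) - (bef z x y - g z x y) + (g y z w - g x z w).

Variable w : nat -> T.
Hypothesis h_w : forall i j, (i < 6)%N -> (j < 6)%N -> (h (w i) < h (w j)) = (i < j)%N.

Let edge := (nat * nat)%type.
Let ov (p : edge * edge) : bool := par (om (w p.1.1) (w p.1.2) (w p.2.1) (w p.2.2)).
Let gv (p : nat * edge) : bool := par (g (w p.1) (w p.2.1) (w p.2.2)).

Definition orient (e : edge) : edge := if (e.1 < e.2)%N then e else (e.2, e.1).

Let ov_orient p : ov p = ov (orient p.1, orient p.2).
Proof.
case: p => [[a b] [c d]]; rewrite /ov /orient /=.
by case: ifP => _; case: ifP => _ //=; rewrite ?(omN (w a)) ?parN ?(omNr _ _ (w c)) ?parN.
Qed.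

(** The nine pairs of edges whose overcrossings add up to the linking number of
the two triangles. *)
Definition edge_pairs (s : seq nat) : seq (edge * edge) :=
  [seq (orient p, orient q) | p <- zip (take 3 s) (rot 1 (take 3 s)),
                              q <- zip (drop 3 s) (rot 1 (drop 3 s))].

Lemma par_cyc2 s : par (cyc2 om (map w (take 3 s)) (map w (drop 3 s)))
  = \big[addb/false]_(p <- edge_pairs s) ov p.
Proof.
rewrite /cyc2 /cyc -!map_rot.
have zm (r t : seq nat) : zip (map w r) (map w t) = [seq (w p.1, w p.2) | p <- zip r t].
  by elim: r t => [|x r IH] [|y t] //=; rewrite IH.
rewrite !zm big_map par_sum /edge_pairs big_allpairs_dep; apply: eq_bigr => p _ /=.
by rewrite big_map par_sum; apply: eq_bigr => q _; exact: (ov_orient (p, q)).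
Qed.

(** The fifteen unordered pairs of disjoint edges in the K5 on 1, ..., 5. *)
Definition crossing_pairs : seq (edge * edge) :=
  [seq c <- [seq (e, e') | e <- [seq (i, j) | i <- iota 1 5, j <- iota 1 5],
                           e' <- [seq (i, j) | i <- iota 1 5, j <- iota 1 5]] |
    [&& c.1.1 < c.1.2, c.2.1 < c.2.2, c.1.1 < c.2.1 & uniq [:: c.1.1; c.1.2; c.2.1; c.2.2]]]%N.

(** Each end of one of the two edges, together with the other edge. *)
Definition vertex_edges (c : edge * edge) : seq (nat * edge) :=
  [:: (c.2.2, c.1); (c.2.1, c.1); (c.1.2, c.2); (c.1.1, c.2)].

(** Whether the ends of the two edges interleave. *)
Definition before_nat (c : edge * edge) : bool :=
  (c.2.2 < c.1.2)%N (+) (c.2.2 < c.1.1)%N (+) (c.2.1 < c.1.2)%N (+) (c.2.1 < c.1.1)%N.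

Lemma w_inj i j : (i < 6)%N -> (j < 6)%N -> w i = w j -> i = j.
Proof.
move=> hi hj e; have := h_w hi hj; have := h_w hj hi; rewrite e ltxx.
by case: ltngtP.
Qed.

Lemma ov_cross c : c \in crossing_pairs ->
  ov c (+) ov (c.2, c.1) = before_nat c (+) \big[addb/false]_(p <- vertex_edges c) gv p.
Proof.
rewrite mem_filter => /andP[/and4P[_ _ _ u4] /allpairsP[[e e'] [ei ei' ec]]].
have bound (i : nat) : i \in iota 1 5 -> (i < 6)%N by rewrite mem_iota => /andP[].
move: ei ei' => /allpairsP[[a b] [/bound a6 /bound b6 ee]].
move=> /allpairsP[[d k] [/bound d6 /bound k6 ee']].
rewrite ec ee ee' /= in u4 *.
have uw : uniq [:: w a; w b; w d; w k].
  have := u4; rewrite /= !inE !negb_or => /and4P[/and3P[ab ad ak] /andP[bd bk] dk _].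
  have ne i j : (i < 6)%N -> (j < 6)%N -> i != j -> w i != w j.
    by move=> hi hj; apply: contra_neq; exact: w_inj.
  by rewrite !ne.
have := congr1 par (omX uw).
rewrite /ov /gv /vertex_edges /before_nat /bef !big_cons big_nil /= !(parD, parN) !h_w // => ->.
do 4 (case: (_ < _)%N => /=); do 4 (case: (par (g _ _ _)) => //=).
Qed.

(** For disjoint edges e and e' of the K5, the count of e over e' and that of e'
over e occur once each in the ten links; the count of an edge at the vertex 0
over an edge of the K5 occurs twice.  The pairs of [vertex_edges] occur twice
each, and five of the fifteen pairs of edges interleave. *)
Lemma K6_odd :
  \big[addb/false]_(s <- splits) par (cyc2 om (map w (take 3 s)) (map w (drop 3 s))) = true.
Proof.
under eq_bigr => s _ do rewrite par_cyc2.
transitivity (\big[addb/false]_(p <- flatten [seq edge_pairs s | s <- splits]) ov p).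
  by rewrite big_flatten big_map.
(* pairs with an edge at 0 cancel, and the others are grouped in twos *)
rewrite (@xor_eq _ _ (flatten [seq [:: c; (c.2, c.1)] | c <- crossing_pairs])); last by vm_compute.
rewrite big_flatten big_map /=.
transitivity (\big[addb/false]_(c <- crossing_pairs)
    (before_nat c (+) \big[addb/false]_(p <- vertex_edges c) gv p)).
  by apply: eq_big_seq => c /ov_cross <-; rewrite !big_cons big_nil /= addbF.
rewrite big_split /=.
have -> : \big[addb/false]_(c <- crossing_pairs) \big[addb/false]_(p <- vertex_edges c) gv p = false.
  transitivity (\big[addb/false]_(p <- flatten [seq vertex_edges c | c <- crossing_pairs]) gv p).
    by rewrite big_flatten big_map.
  by apply: xor_even; vm_compute.
rewrite addbF unlock; by vm_compute.
Qed.
End CompleteGraphSix.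

(** * Pairs of triangles on a given set of six vertices *)

(** A triangle consists of all pairs of its three vertices, so its edge set
depends on its vertex set alone. *)
Lemma triangle_edges (T : finType) (s : seq T) : uniq s -> size s = 3%N ->
  cycle_edges s = [set E : {set T} | E \subset [set x in s] & #|E| == 2%N].
Proof.
move=> us s3; apply/eqP; rewrite eqEcard cards_draws card_cycle_edges ?s3 //.
have -> : #|[set x in s]| = 3%N by rewrite (eq_card (in_set (mem s))) (card_uniqP us).
rewrite andbT; apply/subsetP=> _ /imsetP[x xs ->]; rewrite inE; apply/andP; split.
  by apply/subsetP=> y /set2P[] ->; rewrite inE ?mem_next.
by rewrite cards2 [x == _]eq_sym next_neq ?s3.
Qed.

Lemma triangle_edges_perm (T : finType) (s t : seq T) : uniq s -> size s = 3%N ->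
  perm_eq s t -> cycle_edges s = cycle_edges t.
Proof.
move=> us s3 st; rewrite !triangle_edges -?(perm_uniq st) -?(perm_size st) //.
have -> // : [set x in s] = [set x in t].
by apply/setP=> x; rewrite !inE (perm_mem st).
Qed.

Lemma cover_set2 (T : finType) (C D : {set {set T}}) :
  cover (cover [set C; D]) = cover C :|: cover D.
Proof.
apply/setP=> x; rewrite inE; apply/bigcupP/orP => [[E /bigcupP[X]]|[]/bigcupP[E EX xE]].
- by case/set2P=> -> EX xE; [left|right]; apply/bigcupP; exists E.
- by exists E => //; apply/bigcupP; exists C; rewrite // !inE eqxx.
- by exists E => //; apply/bigcupP; exists D; rewrite // !inE eqxx orbT.
Qed.

(** Checked for each of the 720 orderings of the six vertices. *)
Lemma splits_complete s : s \in permutations (iota 0 6) ->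
  exists2 r, r \in splits &
    perm_eq (take 3 s) (take 3 r) /\ perm_eq (drop 3 s) (drop 3 r) \/
    perm_eq (take 3 s) (drop 3 r) /\ perm_eq (drop 3 s) (take 3 r).
Proof.
have : all (fun s => has (fun r => perm_eq (take 3 s) (take 3 r) && perm_eq (drop 3 s) (drop 3 r)
   || perm_eq (take 3 s) (drop 3 r) && perm_eq (drop 3 s) (take 3 r)) splits)
   (permutations (iota 0 6)) by vm_compute.
move/allP=> h /h /hasP[r rs /orP[]/andP[e e']]; exists r => //; [left|right]; split=> //.
Qed.

Lemma splits_distinct r r' : r \in splits -> r' \in splits ->
  ~~ perm_eq (take 3 r) (drop 3 r') /\ (perm_eq (take 3 r) (take 3 r') -> r = r').
Proof.
have : all (fun r => all (fun r' => ~~ perm_eq (take 3 r) (drop 3 r')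
    && (perm_eq (take 3 r) (take 3 r') ==> (r == r'))) splits) splits by vm_compute.
move/allP=> h /h /allP h' /h' /andP[a /implyP b]; split=> // /b /eqP //.
Qed.

Section SixSubset.
Variables (n : nat) (w : nat -> 'I_n) (W : {set 'I_n}).
Hypothesis w_inj : forall i j, (i < 6)%N -> (j < 6)%N -> w i = w j -> i = j.
Hypothesis wW : forall x, x \in W <-> exists2 i, (i < 6)%N & x = w i.
Notation K := (@complete n).

Definition split_link (r : seq nat) : {set {set {set 'I_n}}} :=
  [set cycle_edges (map w (take 3 r)); cycle_edges (map w (drop 3 r))].

Let splitP r : r \in splits -> [/\ uniq r, size r = 6%N & r =i iota 0 6].
Proof.
rewrite mem_filter mem_permutations => /andP[_ pr].
by split; [rewrite (perm_uniq pr) | rewrite (perm_size pr) | exact: perm_mem].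
Qed.

Let lt6 (r A : seq nat) : r =i iota 0 6 -> {subset A <= r} -> {in A, forall i, (i < 6)%N}.
Proof. by move=> e sub i /sub; rewrite e mem_iota. Qed.

Lemma map_w_uniq (A : seq nat) : {in A, forall i, (i < 6)%N} -> uniq A -> uniq (map w A).
Proof. by move=> A6 uA; rewrite map_inj_in_uniq // => i j /A6 i6 /A6 j6; exact: w_inj. Qed.

Let map_w_perm (A B : seq nat) : uniq A -> uniq B ->
  {in A, forall i, (i < 6)%N} -> {in B, forall i, (i < 6)%N} ->
  cycle_edges (map w A) = cycle_edges (map w B) -> perm_eq A B.
Proof.
move=> uA uB A6 B6 e.
have sub (D D' : seq nat) : {in D, forall i, (i < 6)%N} -> {in D', forall i, (i < 6)%N} ->
    cycle_edges (map w D) = cycle_edges (map w D') -> {subset D <= D'}.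
  move=> D6 D'6 eD i iD; have := cover_cycle_edges (map w D).
  rewrite eD cover_cycle_edges => /setP/(_ (w i)); rewrite !inE (map_f w iD).
  by case/mapP=> j jD'; move/(w_inj (D6 _ iD) (D'6 _ jD')) => ->.
by apply: uniq_perm => // i; apply/idP/idP; apply: sub.
Qed.

Lemma split_half r : r \in splits ->
  [/\ uniq (take 3 r), uniq (drop 3 r), {in take 3 r, forall i, (i < 6)%N},
      {in drop 3 r, forall i, (i < 6)%N} & size (take 3 r) = 3%N /\ size (drop 3 r) = 3%N].
Proof.
case/splitP=> ur sr er; split.
- exact: take_uniq.
- exact: drop_uniq.
- by apply: (lt6 er) => i; exact: mem_take.
- by apply: (lt6 er) => i; exact: mem_drop.
- by rewrite size_take size_drop sr.
Qed.

Lemma split_disjoint r : r \in splits ->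
  [disjoint map w (take 3 r) & map w (drop 3 r)].
Proof.
move=> rs; have [ur sr er] := splitP rs; have [_ _ t6 d6 _] := split_half rs.
rewrite disjoint_subset; apply/subsetP=> _ /mapP[i it ->]; rewrite inE.
apply/negP=> /mapP[j jd /(w_inj (t6 _ it) (d6 _ jd)) ij].
by move: ur; rewrite -(cat_take_drop 3 r) cat_uniq => /and3P[_ /hasPn/(_ j jd)]; rewrite /= -ij it.
Qed.

(** The elements of Gamma supported on [W], without repetition. *)
Lemma split_links :
  perm_eq (enum [set l in Gamma K 3 3 | cover (cover l) == W]) [seq split_link r | r <- splits].
Proof.
have neq r : r \in splits -> cycle_edges (map w (take 3 r)) != cycle_edges (map w (drop 3 r)).
  move=> rs; have [ut ud t6 d6 _] := split_half rs; apply/eqP=> /(map_w_perm ut ud t6 d6).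
  by have [/negP] := splits_distinct rs rs.
apply: uniq_perm; rewrite ?enum_uniq //.
  rewrite map_inj_in_uniq ?filter_uniq ?permutations_uniq // => r r' rs rs' /eqP.
  have [ut ud t6 d6 _] := split_half rs; have [ut' ud' t6' d6' _] := split_half rs'.
  rewrite eq_set2 ?neq // => /orP[]/eqP[e1 e2].
    by have [_] := splits_distinct rs rs'; apply; exact: map_w_perm.
  by have [/negP[]] := splits_distinct rs rs'; exact: map_w_perm.
move=> l; rewrite mem_enum inE GammaE; apply/andP/mapP => [[/imsetP[[C D]]]|[r rs ->]].
  rewrite inE => /and3P[/= /is_cycleP[_ [s [us ->]]] /is_cycleP[_ [t [ut ->]]] dis] ->.
  rewrite cover_set2 !cover_cycle_edges => /eqP/setP stW.
  have stw x : x \in s ++ t -> {i : nat | (i < 6)%N & x = w i}.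
    by move=> xst; apply: cid2; apply/wW; rewrite -stW !inE -mem_cat.
  pose i0 x := if pselect (x \in s ++ t) is left xst then s2val (stw x xst) else 0%N.
  have i0w x : x \in s ++ t -> (i0 x < 6)%N /\ w (i0 x) = x.
    by rewrite /i0; case: pselect => // xst _; case: (stw x xst).
  have i0s : map w (map i0 (s ++ t)) = s ++ t.
    by rewrite -map_comp; apply: map_id_in => x /i0w[].
  have ust : uniq (s ++ t).
    rewrite cat_uniq us ut andbT; apply/hasPn=> x xt; apply/negP=> xs.
    move: dis; rewrite !cover_cycle_edges -setI_eq0 => /eqP/setP/(_ x).
    by rewrite !inE xt; move: xs => /= ->.
  pose sg := map i0 (s ++ t).
  have usg : uniq sg by apply: (@map_uniq _ _ w); rewrite i0s.
  have sgP : sg \in permutations (iota 0 6).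
    rewrite mem_permutations; apply: uniq_perm => //.
    have sub : {subset sg <= iota 0 6}.
      by move=> _ /mapP[x /i0w[lx _] ->]; rewrite mem_iota.
    by have [|_] := uniq_min_size usg sub; first by rewrite size_map size_cat !size_tuple.
  have es : tval s = map w (take 3 sg).
    by rewrite map_take /sg i0s take_size_cat // size_tuple.
  have et : tval t = map w (drop 3 sg).
    by rewrite map_drop /sg i0s drop_size_cat // size_tuple.
  have [r rs pr] := splits_complete sgP; exists r => //.
  have us' : uniq (map w (take 3 sg)) by rewrite -es.
  have ut' : uniq (map w (drop 3 sg)) by rewrite -et.
  have ss' : size (map w (take 3 sg)) = 3%N by rewrite -es size_tuple.
  have st' : size (map w (drop 3 sg)) = 3%N by rewrite -et size_tuple.
  rewrite /split_link es et; case: pr => [[p1 p2]|[p1 p2]].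
    by rewrite (triangle_edges_perm us' ss' (perm_map w p1)) (triangle_edges_perm ut' st' (perm_map w p2)).
  by rewrite (triangle_edges_perm us' ss' (perm_map w p1)) (triangle_edges_perm ut' st' (perm_map w p2)) setUC.
have [ur sr er] := splitP rs; have [ut ud t6 d6 [st sd]] := split_half rs.
have ce (A : seq nat) : uniq A -> {in A, forall i, (i < 6)%N} -> size A = 3%N ->
    is_cycle K 3 (cycle_edges (map w A)).
  move=> uA A6 sA; have sz : size (map w A) == 3 by rewrite size_map sA.
  by apply/is_cycleP; split=> //; exists (Tuple sz); rewrite /= map_w_uniq.
split.
  apply/imsetP; exists (cycle_edges (map w (take 3 r)), cycle_edges (map w (drop 3 r))) => //.
  rewrite inE /= !ce //= !cover_cycle_edges -setI_eq0; apply/eqP/setP=> x; rewrite !inE.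
  by apply/negP=> /andP[xt]; rewrite (disjointFr (split_disjoint rs)).
rewrite /split_link cover_set2 !cover_cycle_edges; apply/eqP/setP=> x; rewrite !inE -mem_cat -map_cat cat_take_drop.
apply/mapP/idP => [[i]|/wW[i i6 ->]].
  by rewrite er mem_iota => i6 ->; apply/wW; exists i.
by exists i; rewrite // er mem_iota.
Qed.
End SixSubset.

(** * Parity of the sum over pairs of triangles *)

Section Parity.
Variables (R : realType) (n : nat) (f : spatial_embedding R (@complete n)).
Notation point := 'rV[R]_3.
Notation T := 'I_n.
Notation K := (@complete n).
Variables (v u : point).
Hypothesis v0 : v != 0.
Hypothesis gen : generic_for_edges f v u.
Hypothesis n4 : (4 <= n)%N.

(** [K6_odd] wants the vertices listed from left to right. *)
Lemma sort_by_abscissa (W : {set T}) : #|W| = 6%N -> exists w : nat -> T,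
  (forall i j, (i < 6)%N -> (j < 6)%N ->
     (abscissa f v u (w i) < abscissa f v u (w j)) = (i < j)%N) /\
  (forall x, x \in W <-> exists2 i, (i < 6)%N & x = w i).
Proof.
move=> W6; have [x0 _] : exists x0, x0 \in W by apply/set0Pn; rewrite -card_gt0 W6.
pose s := sort (fun x y => abscissa f v u x <= abscissa f v u y) (enum W).
have sz : size s = 6%N by rewrite size_sort -cardE.
have hs : sorted <%R [seq abscissa f v u x | x <- s].
  rewrite lt_sorted_uniq_le map_inj_uniq ?sort_uniq ?enum_uniq; last exact: abscissa_inj gen n4.
  by rewrite sorted_map; apply: sort_sorted => x y; exact: le_total.
exists (nth x0 s); split=> [i j i6 j6|x].
  have := lt_sorted_ltn_nth 0 hs; rewrite size_map sz => /(_ i j i6 j6).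
  by rewrite !(nth_map x0) ?sz.
have -> : (x \in W) = (x \in s) by rewrite mem_sort mem_enum.
split=> [xs|[i i6 ->]]; last by rewrite mem_nth ?sz.
by exists (index x s); rewrite ?nth_index // -sz index_mem.
Qed.

Lemma edge_lk_cross (x y z w : T) : uniq [:: x; y; z; w] ->
  edge_lk f v x y z w - edge_lk f v z w x y
  = (before f v u w x y - half_vertex_edge f v u w x y)
    - (before f v u z x y - half_vertex_edge f v u z x y)
    + (half_vertex_edge f v u y z w - half_vertex_edge f v u x z w).
Proof.
move=> uxyzw; have [xy zw _] := uniq4 uxyzw.
by rewrite -(edge_over_cross gen) // /edge_lk (xy : x != y) (zw : z != w).
Qed.

Lemma lk_six_subset (W : {set T}) : #|W| = 6%N ->
  \big[addb/false]_(l in Gamma K 3 3 | cover (cover l) == W) par (lk f l ^+ 2) = true.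
Proof.
move=> W6; have [w [hw wW]] := sort_by_abscissa W6.
have winj := w_inj hw.
rewrite -(K6_odd (edge_lkN f v) (edge_lkNr f v) edge_lk_cross hw).
transitivity (\big[addb/false]_(l in [set l in Gamma K 3 3 | cover (cover l) == W]) par (lk f l ^+ 2)).
  by apply: eq_bigl => l; rewrite inE.
rewrite -big_enum /= (perm_big _ (split_links winj wW)) big_map.
apply: eq_big_seq => r rs.
have [ut ud t6 d6 [st sd]] := split_half rs.
rewrite (lk_sqr v0 gen) ?par_sqr ?size_map ?st ?sd //.
- exact: map_w_uniq winj _ t6 ut.
- exact: map_w_uniq winj _ d6 ud.
- exact: split_disjoint winj _ rs.
Qed.

(** This refines the theorem of Conway and Gordon that every spatial K6 contains
a nonsplit link. *)
Theorem par_sum_triangles :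
  par (\sum_(l in Gamma K 3 3) lk f l ^+ 2) = odd 'C(n, 6).
Proof.
rewrite par_sum (partition_big (fun l => cover (cover l)) (fun W => #|W| == 6%N)) /=; last first.
  move=> l; rewrite GammaE => /imsetP[[C D]].
  rewrite inE => /and3P[/= /is_cycleP[_ [s [us ->]]] /is_cycleP[_ [t [ut ->]]] dis] ->.
  move: dis; rewrite cover_set2 !cover_cycle_edges -setI_eq0 cardsU => /eqP ->.
  rewrite cards0 subn0 (eq_card (in_set (mem s))) (eq_card (in_set (mem t))).
  by rewrite (card_uniqP us) (card_uniqP ut) !size_tuple.
under eq_bigr => W /eqP W6 do rewrite lk_six_subset //.
rewrite big_const.
have it k : iter k (addb true) false = odd k by elim: k => //= k ->.
rewrite it -[n in RHS](card_ord n) -card_draws; congr odd.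
by apply: eq_card => W; rewrite inE.
Qed.
End Parity.

(** By the Vandermonde identity and since the binomial coefficients of 8 are even
except for the outermost ones, the parity has period 8 in [n]. *)
Lemma odd_bin6 n : odd 'C(n, 6) = (n %% 8 \in [:: 6; 7])%N.
Proof.
have [k [r [r8 ->]]] : exists k r, (r < 8)%N /\ n = (k * 8 + r)%N.
  by exists (n %/ 8)%N, (n %% 8)%N; rewrite ltn_mod -divn_eq.
rewrite modnMDl modn_small //; elim: k => [|k IH].
  by case: r r8 => [|[|[|[|[|[|[|[|r]]]]]]]].
rewrite mulSn -addnA -binomial.Vandermonde -IH.
rewrite !big_ord_recl big_ord0 !lift0.
rewrite (erefl : 'C(8, 0) = 1%N) (erefl : 'C(8, 1) = 8%N) (erefl : 'C(8, 2) = 28%N).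
rewrite (erefl : 'C(8, 3) = 56%N) (erefl : 'C(8, 4) = 70%N) (erefl : 'C(8, 5) = 56%N).
rewrite (erefl : 'C(8, 6) = 28%N) subn0; lia.
Qed.

(** For [m] beyond [n / 2], this is the number of ordered pairs [(p, q)] with sum
[n] and entries at least 3, gathered by their smaller entry. *)
Lemma count_unordered n m : (6 <= n)%N ->
  (\sum_(i < m) (if (3 <= i) && (2 * i <= n) then if 2 * i == n then 1 else 2 else 0)
   = minn (2 * (m - 3)) (n - 5))%N.
Proof.
move=> n6; elim: m => [|m IH]; first by rewrite big_ord0 min0n.
rewrite big_ord_recr /= IH; case: ifP; [case: eqP|]; lia.
Qed.

(** * The congruences *)

Lemma odd_halfz (S : int) (b : bool) : par S = b -> exists k, S = b%:Z + 2 * k.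
Proof.
by move=> e; exists ((S - b%:Z) %/ 2)%Z; move: e; rewrite /par; case: b; lia.
Qed.

Lemma odd_multiple_mod (S m c d : int) (b : bool) : par S = b -> 2 * m = d -> c = m ->
  (m * S = (if b then c else 0) %[mod d])%Z.
Proof.
move=> /odd_halfz[k ->] <- ->; apply/eqP; rewrite eqz_mod_dvd; apply/dvdzP; exists k.
by case: b; rewrite ?(erefl : true%:Z = 1) ?(erefl : false%:Z = 0); ring.
Qed.

Theorem corollary1p6 (R : realType) (n p q : nat)
    (hn : (6 <= n)%N) (hp : (3 <= p)%N) (hq : (3 <= q)%N) (hpq : n = (p + q)%N)
    (f : spatial_embedding R (@complete n)) :
  [/\ p = q ->
      (\sum_(lambda in Gamma (@complete n) p q) lk f lambda ^+ 2
       = (if (n %% 8)%N \in [:: 6; 7]%N then ((n - 6)`!)%N%:Z else 0)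
       %[mod (2 * (n - 6)`!)%N%:Z])%Z,
      p <> q ->
      (\sum_(lambda in Gamma (@complete n) p q) lk f lambda ^+ 2
       = (if (n %% 8)%N \in [:: 6; 7]%N then (2 * (n - 6)`!)%N%:Z else 0)
       %[mod (4 * (n - 6)`!)%N%:Z])%Z
    & (\sum_(p' < n.+1)
         \sum_(q' < n.+1 | [&& 3 <= p', p' <= q' & p' + q' == n]%N)
           \sum_(lambda in Gamma (@complete n) p' q') lk f lambda ^+ 2
       = (if (n %% 8)%N \in [:: 6; 7]%N then ((n - 5)`!)%N%:Z else 0)
       %[mod (2 * (n - 5)`!)%N%:Z])%Z].
Proof.
have [v [u [v0 gen]]] := generic_pair_embedding f.
have n4 : (4 <= n)%N by exact: leq_trans hn.
pose S := \sum_(l in Gamma (@complete n) 3 3) lk f l ^+ 2.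
have parS : par S = (n %% 8 \in [:: 6; 7])%N by rewrite (par_sum_triangles v0 gen n4) odd_bin6.
have sumG a b : (2 < a)%N -> (2 < b)%N -> n = (a + b)%N ->
    \sum_(l in Gamma (@complete n) a b) lk f l ^+ 2
    = ((if a == b then 1 else 2) * (n - 6)`!)%N%:Z * S.
  move=> a2 b2 nab; have := sum_Gamma_lk_sqr v0 gen a2 b2 nab; rewrite -/S.
  case: eqP => _ e; last by rewrite -[LHS]mul1r e PoszM.
  by apply: (mulfI (isT : (2 : int) != 0)); rewrite e mul1n mulrA.
split=> [pq|pq|].
- rewrite sumG // (introT eqP pq) mul1n; apply: odd_multiple_mod => //.
- by rewrite sumG // (introF eqP pq); apply: odd_multiple_mod; rewrite // -PoszM mulnA.
rewrite [X in (X = _ %[mod _])%Z](_ : _ = ((n - 5)`!)%N%:Z * S); first exact: odd_multiple_mod.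
have -> : ((n - 5)`! = (n - 5) * (n - 6)`!)%N.
  by rewrite (_ : n - 5 = (n - 6).+1)%N ?factS //; lia.
have -> : (n - 5)%N = (\sum_(i < n.+1) (if (3 <= i) && (2 * i <= n) then if 2 * i == n then 1 else 2 else 0))%N.
  by rewrite count_unordered //; lia.
rewrite PoszM -mulrA (big_morph Posz PoszD (erefl : Posz 0 = 0)) mulr_suml.
apply: eq_bigr => i _; case: ifP => [/andP[i3 in2]|no]; last first.
  rewrite mul0r big_pred0 // => j; apply/negbTE/negP=> /and3P[a b /eqP c].
  by move: no; rewrite a /=; lia.
have jn : (n - i < n.+1)%N by lia.
rewrite (big_pred1 (Ordinal jn)) => [|j].
  rewrite sumG /=; [|lia..]; rewrite PoszM -mulrA; congr (Posz _ * _).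
  by congr (if _ then _ else _); lia.
by rewrite /= -val_eqE /= i3 /=; lia.
Qed.
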